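(* Let $(M,F,\Phi)$ be a regular integrable system of type $(k,n)$ with compact orbits, with $M$ connected and $n=2$. If the map $\rho:\mathcal{L}\to H_1(M)/\mathrm{Tor}_{H_1(M)}$ is non-trivial (not identically zero), then there exists a compatible free $S^1$ action on $M$.
   Context: A regular (non-Hamiltonian) integrable system of type $(k,n)$ with compact orbits is a triple $(M,F,\Phi)$, where $M$ is a smooth manifold of dimension $k+n$, $F=(f_1,\dots,f_k):M\to\mathbb{R}^k$ is a smooth submersion, and $\Phi$ is a smooth locally free action of $\mathbb{R}^n$ on $M$ (all isotropy groups are discrete), all of whose orbits are compact, with $F\circ\Phi^{T}=F$ for all $T\in\mathbb{R}^n$. Thus every orbit is an $n$-torus. Orbit space: $\mathcal{O}_M$ is the set of orbits of $\Phi$ with quotient map $q_\Phi:M\to\mathcal{O}_M$. Lattice bundle: for $o\in\mathcal{O}_M$, $\mathcal{L}_o\subset\mathbb{R}^n$ is the common isotropy group of $\Phi$ at the points of $o$ (a lattice of rank $n$), and $\mathcal{L}=\bigsqcup_{o}\mathcal{L}_o\subset\mathcal{O}_M\times\mathbb{R}^n$. The map $\rho$: for $T\in\mathcal{L}_o$ and $x\in q_\Phi^{-1}(o)$ let $\lambda_{T,x}(s)=\Phi^{sT}(x)$, $s\in[0,1]$, a closed path. With $\mathrm{Tor}_{H_1(M)}$ the torsion subgroup of the integral homology $H_1(M)$, define $\rho(T)=[\lambda_{T,x}]\in H_1(M)/\mathrm{Tor}_{H_1(M)}$ (independent of $x$). A compatible $S^1$ action on $M$ is a smooth $S^1$ action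 $\Theta:S^1\times M\to M$ that commutes with $\Phi$ and satisfies $q_\Phi(\Theta(z,p))=q_\Phi(p)$ for all $z\in S^1$, $p\in M$. *)

(* Defs.v *)
From HB Require Import structures.
From mathcomp Require Import all_boot all_order all_algebra.
From mathcomp Require Import all_classical all_reals all_analysis.
From mathcomp Require Import ring_quotient freeg ring.

Set Implicit Arguments.
Unset Strict Implicit.
Unset Printing Implicit Defensive.

Import Order.TTheory GRing.Theory Num.Theory.
Import numFieldNormedType.Exports.

Local Open Scope classical_set_scope.
Local Open Scope ring_scope.

Section Smoothness.
Context {R : realType} {m n : nat}.
Implicit Types (U : set 'rV[R]_m) (f : 'rV[R]_m -> 'rV[R]_n).

(* [f] is of class C^r on [U]; only meaningful for [U] open. *)
Fixpoint class_C (r : nat) U f : Prop :=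
  match r with
  | 0 => forall x, U x -> {for x, continuous f}
  | r'.+1 => (forall x, U x -> differentiable f x) /\
             (forall v, class_C r' U (fun x => 'D_v f x))
  end.

Definition smooth_at f (x : 'rV[R]_m) : Prop :=
  exists U, [/\ open U, U x & forall r, class_C r U f].

End Smoothness.

(* The maps are total: only the values of [chart_map] on [chart_dom] and of
   [chart_inv] on the image of [chart_dom] are relevant. *)
Record chart (R : realType) (M : Type) (d : nat) := Chart {
  chart_dom : set M;
  chart_map :> M -> 'rV[R]_d;
  chart_inv : 'rV[R]_d -> M
}.

Definition chart_cod {R : realType} {M : Type} {d} (c : chart R M d) :
    set 'rV[R]_d :=
  c @` chart_dom c.

Definition is_chart {R : realType} {M : topologicalType} {d}
    (c : chart R M d) : Prop :=
  [/\ open (chart_dom c), open (chart_cod c),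
      {within chart_dom c, continuous c},
      {within chart_cod c, continuous (chart_inv c)} &
      forall p, chart_dom c p -> chart_inv c (c p) = p].

Definition smooth_transition {R : realType} {M : Type} {d}
    (c c' : chart R M d) : Prop :=
  forall p, chart_dom c p -> chart_dom c' p ->
    smooth_at (c' \o chart_inv c) (c p).

Definition is_atlas {R : realType} {M : topologicalType} {d}
    (A : set (chart R M d)) : Prop :=
  [/\ forall c, A c -> is_chart c,
      forall p, exists2 c, A c & chart_dom c p &
      forall c c', A c -> A c' -> smooth_transition c c'].

(* Continuity of [f] makes the coordinate expression of [f] meaningful near
   every point at which it is required to be smooth. *)
Definition smooth_map {R : realType} {M N : topologicalType} {m n}
    (A : set (chart R M m)) (B : set (chart R N n)) (f : M -> N) : Prop :=
  continuous f /\
  forall c c' p, A c -> B c' -> chart_dom c p -> chart_dom c' (f p) ->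
    smooth_at (c' \o f \o chart_inv c) (c p).

(* The atlas need not be maximal; it determines the smooth structure. *)
Record manifold (R : realType) (d : nat) := Manifold {
  manifold_sort :> topologicalType;
  atlas : set (chart R manifold_sort d);
  manifold_hausdorff : hausdorff_space manifold_sort;
  manifold_second_countable : @second_countable manifold_sort;
  atlasP : is_atlas atlas
}.
Arguments atlas {R d} _.

Definition euclidean_atlas (R : realType) (n : nat) :
    set (chart R 'rV[R]_n n) :=
  [set Chart setT id id].
Arguments euclidean_atlas : clear implicits.

Definition prod_chart {R : realType} {M N : Type} {m n}
    (c : chart R M m) (c' : chart R N n) : chart R (M * N)%type (m + n) :=
  Chart (chart_dom c `*` chart_dom c')
        (fun p => row_mx (c p.1) (c' p.2))
        (fun v => (chart_inv c (lsubmx v), chart_inv c' (rsubmx v))).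

Definition prod_atlas {R : realType} {M N : Type} {m n}
    (A : set (chart R M m)) (B : set (chart R N n)) :
    set (chart R (M * N)%type (m + n)) :=
  [set prod_chart c c' | c in A & c' in B].

Section Circle.
Variable R : realType.

Definition unit_circle : set (R * R) :=
  [set z | z.1 ^+ 2 + z.2 ^+ 2 = 1].

Definition S1 : Type := set_type unit_circle.
HB.instance Definition _ := Topological.on S1.

Fact S1_one_subproof : unit_circle (1, 0).
Proof. by rewrite /unit_circle /= expr1n expr0n addr0. Qed.

Definition S1_one : S1 := SigSub (mem_set S1_one_subproof).

Fact S1_mul_subproof (z w : S1) :
  unit_circle ((val z).1 * (val w).1 - (val z).2 * (val w).2,
               (val z).1 * (val w).2 + (val z).2 * (val w).1).
Proof.
case: z w => -[a b] /set_mem /= zE [[c d] /set_mem /= wE].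
rewrite /unit_circle /= in zE wE *.
have -> : (a * c - b * d) ^+ 2 + (a * d + b * c) ^+ 2 =
          (a ^+ 2 + b ^+ 2) * (c ^+ 2 + d ^+ 2) by ring.
by rewrite zE wE mulr1.
Qed.

(* Multiplication of complex numbers of modulus 1. *)
Definition S1_mul (z w : S1) : S1 := SigSub (mem_set (S1_mul_subproof z w)).

Fact S1_stereo_inv_subproof (b : bool) (v : 'rV[R]_1) :
  let t := v 0 0 in
  unit_circle (2 * t / (t ^+ 2 + 1), (-1) ^+ b * ((t ^+ 2 - 1) / (t ^+ 2 + 1))).
Proof.
move=> t; rewrite /unit_circle /=.
have t0 : t ^+ 2 + 1 != 0 by rewrite gt_eqF// ltr_wpDl// sqr_ge0.
by rewrite (exprMn _ ((-1) ^+ b)) sqrr_sign mul1r; field.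
Qed.

(* Stereographic projection from the pole [(0, (-1) ^+ b)]. *)
Definition S1_chart (b : bool) : chart R S1 1 :=
  Chart [set z : S1 | (val z).2 != (-1) ^+ b]
        (fun z => const_mx ((val z).1 / (1 - (-1) ^+ b * (val z).2)))
        (fun v => SigSub (mem_set (S1_stereo_inv_subproof b v))).

Definition S1_atlas : set (chart R S1 1) := range S1_chart.

End Circle.
Arguments S1_atlas : clear implicits.

Section Homology.
Variable R : realType.

Definition simplex_set (q : nat) : set 'rV[R]_q.+1 :=
  [set x | (forall i, 0 <= x 0 i) /\ \sum_i x 0 i = 1].

Arguments simplex_set : clear implicits.

Definition simplex (q : nat) : Type := set_type (simplex_set q).
HB.instance Definition _ q := Topological.on (simplex q).

(* [insert0 i x] is [x] with a coordinate 0 inserted at position [i]. *)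
Definition insert0 q (i : 'I_q.+2) (x : 'rV[R]_q.+1) : 'rV[R]_q.+2 :=
  \row_j oapp (x 0) 0 (unlift i j).

Fact face_subproof q (i : 'I_q.+2) (x : simplex q) :
  simplex_set _ (insert0 i (val x)).
Proof.
have [x0 x1] : simplex_set _ (val x) := set_mem (valP x).
split=> [j|]; first by rewrite mxE; case: unliftP => //= j' _.
rewrite (bigD1_ord i) //= mxE unlift_none add0r -[RHS]x1.
by apply: eq_bigr => j _; rewrite mxE liftK.
Qed.

Definition face q (i : 'I_q.+2) (x : simplex q) : simplex q.+1 :=
  SigSub (mem_set (face_subproof i x)).

Fact face_continuous q (i : 'I_q.+2) : continuous (@face q i).
Proof.
apply: continuous_comp_initial => x.
apply: (@continuous_comp _ _ _ set_val (insert0 i)).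
  exact: initial_continuous.
move: (set_val x) => {}x A [P P_x sPA].
have xF : Filter (nbhs x) := nbhs_filter x.
have : nbhs x [set y | forall j, P 0 j (insert0 i y 0 j)].
  apply: (@filter_forall _ _ (fun j => [set y | P 0 j (insert0 i y 0 j)]) _ xF) => j; have := P_x 0 j; rewrite mxE.
  have : forall y : 'rV[R]_q.+1, insert0 i y 0 j = oapp (y 0) 0 (unlift i j).
    by move=> y; rewrite mxE.
  case: (unlift i j) => [j'|] /= E Pj.
    apply: (@filterS _ _ xF _ _ _ (@coord_continuous R 1 q.+1 0 j' x _ Pj)) => y /=.
    by rewrite E.
  apply: (@filterS _ _ xF setT _ _ filterT) => y _ /=.
  by rewrite E; exact: nbhs_singleton.
apply: (@filterS _ _ xF) => y Py; apply: sPA => i0 j; rewrite ord1; exact: Py.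
Qed.
HB.instance Definition _ q (i : 'I_q.+2) :=
  @isContinuous.Build (simplex q) (simplex q.+1) (face i) (@face_continuous q i).

Variable M : topologicalType.

Definition sing (q : nat) : choiceType := continuousType (simplex q) M.

Definition sing_face q (i : 'I_q.+2) (s : sing q.+1) : sing q := s \o face i.

Definition boundary q (c : {freeg (sing q.+1) / int}) : {freeg (sing q) / int} :=
  fglift (fun s => \sum_(i < q.+2) (-1) ^+ i *: << sing_face i s >>) c.

Fact boundaryB q : {morph @boundary q : c d / c - d}.
Proof. exact: lift_is_additive. Qed.

Fact boundary0 q : @boundary q 0 = 0.
Proof. by rewrite -[X in boundary X](subrr 0) (boundaryB 0 0) subrr. Qed.

Definition is_cycle1 : {pred {freeg (sing 1) / int}} :=
  [pred c | boundary c == 0].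

Fact is_cycle1_zmod_closed : zmod_closed is_cycle1.
Proof.
split=> [|c d]; rewrite !inE; first by rewrite boundary0.
by rewrite boundaryB => /eqP -> /eqP ->; rewrite subrr.
Qed.
HB.instance Definition _ :=
  GRing.isZmodClosed.Build {freeg (sing 1) / int} is_cycle1 is_cycle1_zmod_closed.

Record cycle1 := Cycle1 { cycle1_val :> {freeg (sing 1) / int};
                          _ : cycle1_val \in is_cycle1 }.
HB.instance Definition _ := [isSub for cycle1_val].
HB.instance Definition _ := [Choice of cycle1 by <:].
HB.instance Definition _ := [SubChoice_isSubZmodule of cycle1 by <:].

Definition is_boundary1 : {pred cycle1} :=
  [pred z : cycle1 | `[< exists c : {freeg (sing 2) / int}, boundary c = val z >]].

Fact is_boundary1_zmod_closed : zmod_closed is_boundary1.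
Proof.
split=> [|z w]; rewrite !inE; first by exists 0; rewrite boundary0.
move=> [c cz] [d dw]; exists (c - d).
by rewrite boundaryB cz dw.
Qed.
HB.instance Definition _ :=
  GRing.isZmodClosed.Build cycle1 is_boundary1 is_boundary1_zmod_closed.

Definition homology1 : zmodType := Quotient.quot is_boundary1.

End Homology.

Section Torsion.
Variable V : zmodType.

Definition is_torsion : {pred V} :=
  [pred x : V | `[< exists2 m, (0 < m)%N & x *+ m = 0 >]].

Fact is_torsion_zmod_closed : zmod_closed is_torsion.
Proof.
split=> [|x y]; rewrite !inE; first by exists 1.
move=> [a a0 ax] [b b0 bx].
exists (a * b)%N; first by rewrite muln_gt0 a0.
by rewrite mulrnBl mulrnA ax mul0rn mulnC mulrnA bx mul0rn subrr.
Qed.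
HB.instance Definition _ :=
  GRing.isZmodClosed.Build V is_torsion is_torsion_zmod_closed.

Definition mod_torsion : zmodType := Quotient.quot is_torsion.

End Torsion.

Section Homology.
Variables (R : realType) (M : topologicalType).

Definition homology1_mod_torsion : zmodType := mod_torsion (homology1 R M).

Local Open Scope quotient_scope.
Definition cycle1_class (z : cycle1 R M) : homology1_mod_torsion :=
  \pi_(homology1_mod_torsion) (\pi_(homology1 R M) z).

End Homology.

Definition isotropy {R : realType} {n} {M : Type}
    (Phi : 'rV[R]_n -> M -> M) (x : M) : set 'rV[R]_n :=
  [set T | Phi T x = x].

Definition orbit_of {R : realType} {n} {M : Type}
    (Phi : 'rV[R]_n -> M -> M) (x : M) : set M :=
  [set Phi T x | T in [set: 'rV[R]_n]].

Definition submersion {R : realType} {d m} (M : manifold R d)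
    (f : M -> 'rV[R]_m) : Prop :=
  forall c p, atlas M c -> chart_dom c p ->
    forall w, exists v, 'd (f \o chart_inv c) (c p) v = w.

Record integrable_system (R : realType) (k n : nat) := IntegrableSystem {
  system_manifold :> manifold R (k + n);
  fintegrals : system_manifold -> 'rV[R]_k;
  flow : 'rV[R]_n -> system_manifold -> system_manifold;
  fintegrals_smooth :
    smooth_map (atlas system_manifold) (euclidean_atlas R k) fintegrals;
  fintegrals_submersion : submersion fintegrals;
  flow_smooth :
    smooth_map (prod_atlas (euclidean_atlas R n) (atlas system_manifold))
      (atlas system_manifold) (fun p => flow p.1 p.2);
  flow0 : forall x, flow 0 x = x;
  flowD : forall S T x, flow (S + T) x = flow S (flow T x);
  (* discreteness of the isotropy groups *)
  flow_locally_free : forall x, isolated (isotropy flow x) = isotropy flow x;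
  flow_orbit_compact : forall x, compact (orbit_of flow x);
  fintegrals_flow : forall T x, fintegrals (flow T x) = fintegrals x
}.

Arguments flow {R k n} _ _ _.

Section System.
Context {R : realType} {k n : nat} (S : integrable_system R k n).

Definition orbit_space : Type := set_type (range (orbit_of (flow S))).

Fact quotient_map_subproof (x : S) :
  range (orbit_of (flow S)) (orbit_of (flow S) x).
Proof. by exists x. Qed.

Definition quotient_map (x : S) : orbit_space :=
  SigSub (mem_set (quotient_map_subproof x)).

Definition lattice (o : orbit_space) : set 'rV[R]_n :=
  [set T | forall x, quotient_map x = o -> isotropy (flow S) x T].

Definition lattice_bundle : Type := {o : orbit_space & set_type (lattice o)}.

(* [Delta^1] is identified with [[0, 1]] through the second barycentric
   coordinate. *)
Definition loop (T : 'rV[R]_n) (x : S) (s : simplex R 1) : S :=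
  flow S (val s 0 1 *: T) x.

Fact loop_continuous T x : continuous (loop T x).
Proof.
move=> s.
apply: (@continuous_comp _ _ _ (fun s : simplex R 1 => (val s 0 1 *: T, x))
          (fun p => flow S p.1 p.2)); last exact: (flow_smooth S).1.
have sF : Filter (nbhs s) := nbhs_filter s.
have TF : Filter (nbhs (val s 0 1 *: T)) := nbhs_filter _.
have xF : Filter (nbhs x) := nbhs_filter _.
apply: (@cvg_pair _ _ _ (nbhs s) _ _ sF TF xF); last exact: cvg_cst.
apply: cvgZr_tmp.
apply: (@continuous_comp _ _ _ set_val (fun v : 'rV[R]_2 => v 0 1)).
  exact: initial_continuous.
exact: coord_continuous.
Qed.

Definition loop_simplex T x : sing R S 1 := mkcts (@loop_continuous T x).

Fact loop_cycle_subproof T x :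
  isotropy (flow S) x T -> << loop_simplex T x >> \in @is_cycle1 R S.
Proof.
move=> Tx; rewrite inE /boundary liftU scale1r !big_ord_recl big_ord0 /=.
suff -> : sing_face ord0 (loop_simplex T x) =
          sing_face (fintype.lift ord0 ord0) (loop_simplex T x).
  by rewrite addr0 expr0 expr1 scale1r scaleN1r subrr.
apply/continuousEP => p; rewrite /sing_face /= /mkcts /loop /=.
have p1 : val p 0 0 = 1.
  by have [_] := set_mem (valP p); rewrite big_ord1.
rewrite !mxE; have -> : (1 : 'I_2) = fintype.lift ord0 ord0 by exact: val_inj.
by rewrite liftK unlift_none /= p1 scale1r scale0r flow0.
Qed.

Definition loop_class T x (Tx : isotropy (flow S) x T) :
    homology1_mod_torsion R S :=
  cycle1_class (Cycle1 (loop_cycle_subproof Tx)).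

Fact orbit_point_subproof (o : orbit_space) : exists x, quotient_map x = o.
Proof.
case: o => o oP; have [x _ xo] := set_mem oP.
by exists x; apply: val_inj.
Qed.

Definition orbit_point (o : orbit_space) : S :=
  projT1 (cid (orbit_point_subproof o)).

Fact orbit_pointP (o : orbit_space) : quotient_map (orbit_point o) = o.
Proof. exact: projT2 (cid (orbit_point_subproof o)). Qed.

(* The class does not depend on the point of the orbit, since the orbits are
   path connected. *)
Definition rho (l : lattice_bundle) : homology1_mod_torsion R S :=
  loop_class (set_mem (valP (projT2 l)) _ (orbit_pointP (projT1 l))).

Definition compatible_S1_action (Theta : S1 R -> S -> S) : Prop :=
  [/\ [/\ smooth_map (prod_atlas (S1_atlas R) (atlas S)) (atlas S)
             (fun p => Theta p.1 p.2),
           forall p, Theta (S1_one R) p = p &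
           forall z w p, Theta (S1_mul z w) p = Theta z (Theta w p)],
      forall z T p, Theta z (flow S T p) = flow S T (Theta z p) &
      forall z p, quotient_map (Theta z p) = quotient_map p].

Definition free_S1_action (Theta : S1 R -> S -> S) : Prop :=
  forall z p, Theta z p = p -> z = S1_one R.

End System.

(* Main.v *)
(* A period map is a smooth map [P] from [M] to R^2, invariant under the action,
   such that [P x] is a primitive element of the isotropy lattice of [x]; the
   circle then acts freely by [e^(2 i pi a) . x = Phi^(a P(x))(x)].

   By the implicit function theorem each lattice element extends to a local
   smooth section of the lattice bundle, and bases extend to bases, since the
   orbits are compact; along such sections rho is constant. As [M] is connected,
   it suffices to find at one point an oriented lattice basis (T1, T2) such that
   any other oriented basis with the same classes rho(T1), rho(T2) has the same
   first vector: the set of points with a basis of these classes is open and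
   closed, and its first vector is [P]. If the classes of a basis are
   Z-independent, the whole basis is determined by them. Otherwise, as the target
   of rho is torsion free, some basis has rho(T1) = 0 and rho(T2) != 0, and then
   T1 is determined up to sign by its class and its sign by the orientation. *)

(* The obstacle is monodromy: a period extends to nearby points, but its continuation around a loop
   may return another period. The classes lie in one fixed group and the orientation is continuous,
   so a period singled out by these data is single-valued. In rank two a nonzero rho has a kernel of
   rank at most one, and a lattice of rank one has only two generators; this is what leaves just a
   sign to be settled.

   The implicit function theorem is applied once, to the time at which a point reaches a slice
   transverse to its orbit. The generators of the action span the kernel of the differential of F,
   so F and the slice coordinates together separate nearby points. Extension of periods,
   discreteness of the isotropy uniformly in the point, and cocompactness of the isotropy all follow
   from this local time.

   P is chosen point by point; its smoothness comes from uniqueness, which makes it agree near each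
   point with a smooth section. *)
Require Import Defs.
From HB Require Import structures.
From mathcomp Require Import all_boot all_order all_algebra.
From mathcomp Require Import all_classical all_reals all_analysis.
From mathcomp Require Import finmap ring_quotient freeg ring lra.

Set Implicit Arguments.
Unset Strict Implicit.
Unset Printing Implicit Defensive.

Import Order.TTheory GRing.Theory Num.Theory.
Import numFieldNormedType.Exports.

Local Open Scope classical_set_scope.
Local Open Scope ring_scope.

(** * Functions of class C^r on normed modules *)

Section ClassCr.
Context {R : realType}.
Implicit Types (V W : normedModType R).

(** The recursion of [class_C] on arbitrary normed modules, since the inductions pass through scalar
    functions: coordinates, determinants, partial derivatives. *)
Fixpoint Cr V W (r : nat) (U : set V) (f : V -> W) : Prop :=
  match r with
  | 0 => forall x, U x -> {for x, continuous f}
  | r'.+1 => (forall x, U x -> differentiable f x) /\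
             (forall v, Cr r' U (fun x => 'D_v f x))
  end.

Lemma class_CE m n r (U : set 'rV[R]_m) (f : 'rV[R]_m -> 'rV[R]_n) :
  class_C r U f <-> Cr r U f.
Proof.
elim: r U f => [//|r IH] U f /=.
by split=> -[? H]; split=> // v; apply/IH.
Qed.

Lemma Cr_sub V W r (U U' : set V) (f : V -> W) :
  U' `<=` U -> Cr r U f -> Cr r U' f.
Proof.
move=> UU'; elim: r f => [|r IH] f /=; first by move=> H x /UU'; exact: H.
by move=> [df H]; split=> [x /UU'|v]; [exact: df|exact: IH].
Qed.

Lemma near_eq_for_continuous V W (f g : V -> W) (x : V) :
  {near x, f =1 g} -> {for x, continuous f} -> {for x, continuous g}.
Proof.
move=> fg fx; rewrite /prop_for /continuous_at -(nbhs_singleton fg).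
by apply: cvg_trans fx; apply: near_eq_cvg; apply: filterS fg => y ->.
Qed.

Lemma differentiable_eps V W (f : V -> W) (x : V) : differentiable f x ->
  forall e, 0 < e -> \forall h \near (0 : V),
    `|f (h + x) - f x - 'd f x h| <= e * `|h|.
Proof.
move=> /diff_locally /eqaddoP df e e0; apply: filterS (df e e0) => h /=.
by rewrite -[(_ - _ : V -> W) h]/(f (h + x) - (f x + 'd f x h)) opprD addrA.
Qed.

Lemma eps_differentiable V W (f : V -> W) (x : V) (L : {linear V -> W}) :
  continuous L -> (forall e, 0 < e -> \forall h \near (0 : V),
    `|f (h + x) - f x - L h| <= e * `|h|) ->
  differentiable f x /\ 'd f x = L :> (V -> W).
Proof.
move=> Lc H.
have E : f \o shift x = cst (f x) + L +o_ 0 id.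
  apply/eqaddoP => e e0; apply: filterS (H e e0) => h /=.
  by rewrite -[(_ - _ : V -> W) h]/(f (h + x) - (f x + L h)) opprD addrA.
have dE := diff_unique Lc E.
by split=> //; apply/diff_locallyP; rewrite dE.
Qed.

Lemma near_eq_differentiable V W (f g : V -> W) (x : V) :
  {near x, f =1 g} -> differentiable f x -> differentiable g x.
Proof.
move=> fg df; apply: (proj1 (eps_differentiable (diff_continuous df) _)) => e e0.
have : \forall h \near (0 : V), f (h + x) = g (h + x).
  have cx : (h + x) @[h --> (0 : V)] --> x.
    by rewrite -[X in _ --> X]add0r; apply: cvgD; [exact: cvg_id|exact: cvg_cst].
  exact: cx _ fg.
apply: filterS2 (differentiable_eps df e0) => h /= + <-.
by rewrite -(nbhs_singleton fg).
Qed.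

(** Openness turns equality on [U] into equality near each of its points, hence equality of
    derivatives. Most rules below need this, as their derivative formulas hold only on [U]. *)
Lemma Cr_ext V W r (U : set V) (f g : V -> W) :
  open U -> (forall x, U x -> f x = g x) -> Cr r U f -> Cr r U g.
Proof.
move=> oU; elim: r f g => [|r IH] f g fg /=.
  move=> H x Ux; apply: (near_eq_for_continuous _ (H x Ux)).
  by have := open_nbhs_nbhs (conj oU Ux); apply: filterS => y; exact: fg.
have nfg x : U x -> {near x, f =1 g}.
  by move=> Ux; have := open_nbhs_nbhs (conj oU Ux); apply: filterS => y; exact: fg.
move=> [df H]; split=> [x Ux|v]; first exact: near_eq_differentiable (nfg _ Ux) (df _ Ux).
by apply: IH (H v) => x Ux; exact/near_eq_derive/nfg.
Qed.

(** The product, quotient and chain rules mention the functions themselves besides their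
    derivatives; the inductions lower their order with this. *)
Lemma CrS V W r (U : set V) (f : V -> W) : Cr r.+1 U f -> Cr r U f.
Proof.
elim: r f => [|r IH] f [df H]; first by move=> x Ux; exact/differentiable_continuous/df.
by split=> // v; apply: IH.
Qed.

Lemma Cr_cst V W r (U : set V) (w : W) : Cr r U (fun _ => w).
Proof.
elim: r w => [|r IH] w /=; first by move=> x _; exact: cst_continuous.
split=> [x _|v]; first exact: differentiable_cst.
by under eq_fun do rewrite derive_cst.
Qed.

Lemma Cr_lin V W r (U : set V) (f : {linear V -> W}) : continuous f -> Cr r U f.
Proof.
move=> cf; case: r => [|r] /=; first by move=> x _; exact: cf.
split=> [x _|v]; first exact: linear_differentiable.
have -> : 'D_v f = cst (f v).
  by apply/funext => x; rewrite deriveE ?diff_lin //; exact: linear_differentiable.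
exact: Cr_cst.
Qed.

Lemma CrD V W r (U : set V) (f g : V -> W) : open U ->
  Cr r U f -> Cr r U g -> Cr r U (fun x => f x + g x).
Proof.
move=> oU; elim: r f g => [|r IH] f g /=.
  by move=> Hf Hg x Ux; apply: continuousD; [exact: Hf|exact: Hg].
move=> [df Hf] [dg Hg]; split=> [x Ux|v]; first by apply: differentiableD; [exact: df|exact: dg].
apply: (@Cr_ext _ _ _ _ (fun x => 'D_v f x + 'D_v g x)) => //; last exact: IH.
by move=> x Ux; rewrite deriveD //; apply: diff_derivable; [exact: df|exact: dg].
Qed.

Lemma Cr_sum V W r (U : set V) (I : Type) (s : seq I) (P : pred I) (f : I -> V -> W) :
  open U -> (forall i, Cr r U (f i)) -> Cr r U (fun x => \sum_(i <- s | P i) f i x).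
Proof.
move=> oU Hf; elim: s => [|i s IH].
  by under eq_fun do rewrite big_nil; exact: Cr_cst.
under eq_fun do rewrite big_cons.
by case: (P i) => //; apply: CrD.
Qed.

Lemma CrZl V W r (U : set V) (k : V -> R) (w : W) : open U ->
  Cr r U k -> Cr r U (fun x => k x *: w).
Proof.
move=> oU; elim: r k => [|r IH] k /=.
  by move=> Hk x Ux; apply: (@continuous_comp _ _ _ k (fun a => a *: w)); [exact: Hk|exact: scalel_continuous].
move=> [dk Hk]; split=> [x Ux|v]; first exact/differentiableZl/dk.
apply: (@Cr_ext _ _ _ _ (fun x => 'D_v k x *: w)) => //; last exact: IH.
move=> x Ux; rewrite !deriveE; [by rewrite diffZl //; exact: dk|exact/differentiableZl/dk|exact: dk].
Qed.

Lemma CrM V r (U : set V) (f g : V -> R) : open U ->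
  Cr r U f -> Cr r U g -> Cr r U (fun x => f x * g x).
Proof.
move=> oU; elim: r f g => [|r IH] f g.
  by move=> Hf Hg x Ux; apply: continuousM; [exact: Hf|exact: Hg].
move=> Hf Hg; have [df Hf'] := Hf; have [dg Hg'] := Hg.
split=> [x Ux|v]; first by apply: differentiableM; [exact: df|exact: dg].
apply: (@Cr_ext _ _ _ _ (fun x => f x * 'D_v g x + g x * 'D_v f x)) => //.
  by move=> x Ux; rewrite deriveM //; [exact/diff_derivable/df|exact/diff_derivable/dg].
by apply: CrD => //; [exact: (IH _ _ (CrS Hf) (Hg' v))|exact: (IH _ _ (CrS Hg) (Hf' v))].
Qed.

Lemma Cr_prod V r (U : set V) (I : Type) (s : seq I) (f : I -> V -> R) :
  open U -> (forall i, Cr r U (f i)) -> Cr r U (fun x => \prod_(i <- s) f i x).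
Proof.
move=> oU Hf; elim: s => [|i s IH].
  by under eq_fun do rewrite big_nil; exact: Cr_cst.
by under eq_fun do rewrite big_cons; apply: CrM.
Qed.

Lemma CrN V W r (U : set V) (f : V -> W) : open U ->
  Cr r U f -> Cr r U (fun x => - f x).
Proof.
move=> oU; elim: r f => [|r IH] f /=.
  by move=> Hf x Ux; apply: continuousN; exact: Hf.
move=> [df Hf]; split=> [x Ux|v]; first exact/differentiableN/df.
apply: (@Cr_ext _ _ _ _ (fun x => - 'D_v f x)) => //; last exact: IH.
by move=> x Ux; rewrite deriveN //; exact/diff_derivable/df.
Qed.

Lemma CrB V W r (U : set V) (f g : V -> W) : open U ->
  Cr r U f -> Cr r U g -> Cr r U (fun x => f x - g x).
Proof. by move=> oU Hf Hg; apply: CrD => //; exact: CrN. Qed.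

Lemma CrV V r (U : set V) (f : V -> R) : open U ->
  (forall x, U x -> f x != 0) -> Cr r U f -> Cr r U (fun x => (f x)^-1).
Proof.
move=> oU f0; elim: r => [|r IH].
  by move=> Hf x Ux; apply: continuousV; [exact: f0|exact: Hf].
move=> Hf; have [df Hf'] := Hf.
split=> [x Ux|v]; first by apply: differentiableV; [exact: df|exact: f0].
apply: (@Cr_ext _ _ _ _ (fun x => - ((f x)^-1 * (f x)^-1) * 'D_v f x)) => //.
  move=> x Ux; rewrite deriveV ?f0 //; last exact/diff_derivable/df.
  by rewrite -expr2 -exprVn scaleNr mulNr.
apply: CrM => //; last exact: Hf'.
by apply: CrN => //; apply: CrM => //; exact: (IH (CrS Hf)).
Qed.

Lemma differentiable_coordf V m n (f : V -> 'M[R]_(m, n)) i j x :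
  differentiable f x -> differentiable (fun x => f x i j) x.
Proof.
move=> df; apply: (@differentiable_comp _ _ _ _ f (fun M : 'M[R]_(m, n) => M i j)) => //.
exact: differentiable_coord.
Qed.

Lemma Cr_coord V m n r (U : set V) (f : V -> 'M[R]_(m, n)) i j : open U ->
  Cr r U f -> Cr r U (fun x => f x i j).
Proof.
move=> oU; elim: r f => [|r IH] f /=.
  by move=> Hf x Ux; apply: (@continuous_comp _ _ _ f (fun M : 'M[R]_(m, n) => M i j)); [exact: Hf|exact: coord_continuous].
move=> [df Hf]; split=> [x Ux|v]; first exact/differentiable_coordf/df.
apply: (@Cr_ext _ _ _ _ (fun x => ('D_v f x) i j)) => //; last exact: IH.
by move=> x Ux; rewrite derive_mx ?mxE //; exact/diff_derivable/df.
Qed.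

Lemma Cr_coordP V n r (U : set V) (f : V -> 'rV[R]_n) : open U ->
  Cr r U f <-> forall j, Cr r U (fun x => f x 0 j).
Proof.
move=> oU; split=> [Hf j|Hf]; first exact: Cr_coord.
have -> : f = (fun x => \sum_j f x 0 j *: delta_mx 0 j).
  by apply/funext => x; rewrite [LHS]row_sum_delta.
by apply: Cr_sum => // j; exact: CrZl.
Qed.

(** The direction ['D_v f x] varies with [x], whereas [Cr] differentiates in fixed directions;
    expanding over the basis leaves products that the induction can handle. *)
Lemma derive_compE V n (g : 'rV[R]_n -> R) (f : V -> 'rV[R]_n) x v :
  differentiable f x -> differentiable g (f x) ->
  'D_v (g \o f) x = \sum_j ('D_v f x) 0 j * 'D_(delta_mx 0 j) g (f x).
Proof.
move=> df dg; rewrite deriveE; last exact: differentiable_comp.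
rewrite diff_comp //= -(deriveE v df).
transitivity ('d g (f x) (\sum_j ('D_v f x) 0 j *: delta_mx 0 j)).
  by rewrite -row_sum_delta.
rewrite linear_sum; apply: eq_bigr => j _.
by rewrite linearZ /= -deriveE.
Qed.

Lemma Cr_comp_scalar V n r (U : set V) (U' : set 'rV[R]_n)
    (g : 'rV[R]_n -> R) (f : V -> 'rV[R]_n) :
  open U -> open U' -> (forall x, U x -> U' (f x)) ->
  Cr r U f -> Cr r U' g -> Cr r U (g \o f).
Proof.
move=> oU oU' fU; elim: r g => [|r IH] g.
  by move=> Hf Hg x Ux; apply: continuous_comp; [exact: Hf|exact/Hg/fU].
move=> Hf Hg; have [df Hf'] := Hf; have [dg Hg'] := Hg.
split=> [x Ux|v]; first by apply: differentiable_comp; [exact: df|exact/dg/fU].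
apply: (@Cr_ext _ _ _ _ (fun x => \sum_j ('D_v f x) 0 j * 'D_(delta_mx 0 j) g (f x))) => //.
  by move=> x Ux; rewrite derive_compE //; [exact: df|exact/dg/fU].
apply: Cr_sum => // j; apply: CrM => //; first exact: (Cr_coord _ _ oU (Hf' v)).
exact: (IH _ (CrS Hf) (Hg' _)).
Qed.

Lemma Cr_comp V m n r (U : set V) (U' : set 'rV[R]_n)
    (g : 'rV[R]_n -> 'rV[R]_m) (f : V -> 'rV[R]_n) :
  open U -> open U' -> (forall x, U x -> U' (f x)) ->
  Cr r U f -> Cr r U' g -> Cr r U (g \o f).
Proof.
move=> oU oU' fU Hf Hg; apply/Cr_coordP => // j.
by apply: (@Cr_comp_scalar _ _ _ _ U' (fun y => g y 0 j)) => //; exact: Cr_coord.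
Qed.

Lemma Cr_det V n r (U : set V) (A : V -> 'M[R]_n) : open U ->
  (forall i j, Cr r U (fun x => A x i j)) -> Cr r U (fun x => \det (A x)).
Proof.
move=> oU HA; rewrite /determinant; apply: Cr_sum => // s.
by apply: CrM => //; [exact: Cr_cst|exact: Cr_prod].
Qed.

Lemma Cr_invmx V n r (U : set V) (A : V -> 'M[R]_n) i j : open U ->
  (forall i j, Cr r U (fun x => A x i j)) -> (forall x, U x -> A x \in unitmx) ->
  Cr r U (fun x => invmx (A x) i j).
Proof.
move=> oU HA uA.
apply: (@Cr_ext _ _ _ _ (fun x => (\det (A x))^-1 * cofactor (A x) j i)) => //.
  by move=> x Ux; rewrite /invmx uA // !mxE.
apply: CrM => //.
  by apply: CrV => // [x /uA|]; [rewrite unitmxE unitfE|exact: Cr_det].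
rewrite /cofactor; apply: CrM => //; first exact: Cr_cst.
apply: Cr_det => // a b; under eq_fun do rewrite !mxE; exact: HA.
Qed.

Lemma Cr_mulmx V m n p r (U : set V) (A : V -> 'M[R]_(m, n)) (B : V -> 'M[R]_(n, p)) i j :
  open U -> (forall i j, Cr r U (fun x => A x i j)) ->
  (forall i j, Cr r U (fun x => B x i j)) ->
  Cr r U (fun x => (A x *m B x) i j).
Proof.
move=> oU HA HB; under eq_fun do rewrite mxE.
by apply: Cr_sum => // l; exact: CrM.
Qed.

End ClassCr.

Section RowNorm.
Context {R : realType}.

Lemma coord_norm_le m n (M : 'M[R]_(m, n)) i j : `|M i j| <= `|M|.
Proof.
rewrite [leRHS]/Num.Def.normr/= mx_normrE.
exact: (le_bigmax _ (fun ij => `|M ij.1 ij.2|) (i, j)).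
Qed.

Lemma norm_le_coord m n (M : 'M[R]_(m, n)) c : 0 <= c ->
  (forall i j, `|M i j| <= c) -> `|M| <= c.
Proof.
move=> c0 H; rewrite [leLHS]/Num.Def.normr/= mx_normrE.
by apply: bigmax_le => // -[i j] _; exact: H.
Qed.

Lemma norm_row_mx_le m n (u : 'rV[R]_m) (v : 'rV[R]_n) :
  `|row_mx u v| <= `|u| + `|v|.
Proof.
apply: norm_le_coord => [|i j]; first by rewrite addr_ge0.
rewrite mxE; case: (fintype.split _) => k.
  by apply: le_trans (coord_norm_le _ _ _) _; rewrite lerDl.
by apply: le_trans (coord_norm_le _ _ _) _; rewrite lerDr.
Qed.

Lemma norm_row_mxl0 m n (u : 'rV[R]_m) : `|row_mx u (0 : 'rV[R]_n)| <= `|u|.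
Proof. by apply: le_trans (norm_row_mx_le _ _) _; rewrite normr0 addr0. Qed.

Lemma linear_row_continuous m (W : normedModType R) (f : {linear 'rV[R]_m -> W}) :
  continuous f.
Proof.
move=> x; have -> : (f : _ -> _) = (fun x => \sum_j x 0 j *: f (delta_mx 0 j)).
  apply/funext => y; rewrite [in LHS](row_sum_delta y) linear_sum.
  by apply: eq_bigr => j _; rewrite linearZ.
have : Cr 0 setT (fun y : 'rV[R]_m => \sum_j y 0 j *: f (delta_mx 0 j)).
  apply: Cr_sum => [|j]; first exact: openT.
  apply: CrZl => [|y _]; [exact: openT|exact: coord_continuous].
by move=> /(_ x I).
Qed.

End RowNorm.

(** * Smoothness at a point and strict differentiability *)

Section Smooth.
Context {R : realType}.
Implicit Types (V W : normedModType R).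

Definition smooth V W (f : V -> W) (x : V) : Prop :=
  exists U, [/\ open U, U x & forall r, Cr r U f].

Lemma smooth_atE m n (f : 'rV[R]_m -> 'rV[R]_n) x : smooth_at f x <-> smooth f x.
Proof.
by split=> -[U [oU Ux H]]; exists U; split=> // r; apply/class_CE.
Qed.

Lemma smooth_near V W (f : V -> W) x : smooth f x -> \forall y \near x, smooth f y.
Proof.
move=> [U [oU Ux H]]; have := open_nbhs_nbhs (conj oU Ux).
by apply: filterS => y Uy; exists U.
Qed.

Lemma smooth_differentiable V W (f : V -> W) x : smooth f x -> differentiable f x.
Proof. by move=> [U [oU Ux H]]; exact: (H 1%N).1. Qed.

Lemma smooth_continuous V W (f : V -> W) x : smooth f x -> {for x, continuous f}.
Proof. by move=> /smooth_differentiable/differentiable_continuous. Qed.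

Lemma smooth_ext V W (f g : V -> W) x :
  {near x, f =1 g} -> smooth f x -> smooth g x.
Proof.
move=> /nbhs_interior/nbhs_singleton fg [U [oU Ux H]].
exists (U `&` ([set y | f y = g y])^°); split=> [||r].
- by apply: openI => //; exact: open_interior.
- by [].
- apply: (@Cr_ext _ _ _ _ _ f) => [|y [_ /interior_subset]//|].
    by apply: openI => //; exact: open_interior.
  by apply: Cr_sub (H r) => y [].
Qed.

Lemma smooth2 V W W' W'' (op : W -> W' -> W'') (f : V -> W) (g : V -> W') x :
  (forall r U f g, open U -> Cr r U f -> Cr r U g -> Cr r U (fun x : V => op (f x) (g x))) ->
  smooth f x -> smooth g x -> smooth (fun x => op (f x) (g x)) x.
Proof.
move=> Hop [U [oU Ux Hf]] [U' [oU' Ux' Hg]].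
exists (U `&` U'); split=> [||r]; [exact: openI|by []|].
apply: Hop; first exact: openI.
  by apply: Cr_sub (Hf r) => y [].
by apply: Cr_sub (Hg r) => y [].
Qed.

Lemma smoothD V W (f g : V -> W) x : smooth f x -> smooth g x ->
  smooth (fun x => f x + g x) x.
Proof. by apply: (@smooth2 _ _ _ _ +%R) => *; exact: CrD. Qed.

Lemma smoothB V W (f g : V -> W) x : smooth f x -> smooth g x ->
  smooth (fun x => f x - g x) x.
Proof. by apply: (@smooth2 _ _ _ _ (fun a b => a - b)) => *; exact: CrB. Qed.

Lemma smoothM V (f g : V -> R) x : smooth f x -> smooth g x ->
  smooth (fun x => f x * g x) x.
Proof. exact: (@smooth2 _ _ _ _ (@GRing.mul R) f g x (fun r U f g => @CrM _ _ r U f g)). Qed.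

Lemma smoothN V W (f : V -> W) x : smooth f x -> smooth (fun x => - f x) x.
Proof. by move=> [U [oU Ux Hf]]; exists U; split=> // r; exact: CrN. Qed.

Lemma smooth_cst V W (w : W) (x : V) : smooth (fun=> w) x.
Proof. by exists setT; split=> // [|r]; [exact: openT|exact: Cr_cst]. Qed.

Lemma smooth_lin V W (f : {linear V -> W}) x : continuous f -> smooth f x.
Proof. by move=> cf; exists setT; split=> // [|r]; [exact: openT|exact: Cr_lin]. Qed.

Lemma smooth_linrV m W (f : {linear 'rV[R]_m -> W}) x : smooth f x.
Proof. exact/smooth_lin/linear_row_continuous. Qed.

Lemma smooth_id V (x : V) : smooth (fun y => y) x.
Proof. by apply: (@smooth_lin _ _ idfun) => y. Qed.

Lemma smooth_coordP V n (f : V -> 'rV[R]_n) x :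
  smooth f x <-> forall j, smooth (fun y => f y 0 j) x.
Proof.
split=> [[U [oU Ux H]] j|H]; first by exists U; split=> // r; exact: Cr_coord.
have [U HU] := choice H.
have : \forall y \near x, forall j, U j y.
  by apply: filter_forall => j; have [oU Ux _] := HU j; exact: open_nbhs_nbhs.
move=> /nbhs_interior/nbhs_singleton UI.
exists [set y | forall j, U j y]^°; split=> [||r] //; first exact: open_interior.
apply/Cr_coordP => [|j]; first exact: open_interior.
by have [_ _ /(_ r)] := HU j; apply: Cr_sub => y /interior_subset.
Qed.

Lemma smooth_comp V m n (g : 'rV[R]_n -> 'rV[R]_m) (f : V -> 'rV[R]_n) x :
  smooth f x -> smooth g (f x) -> smooth (g \o f) x.
Proof.
move=> [U [oU Ux Hf]] [U' [oU' Ux' Hg]].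
have oUU : open (U `&` f @^-1` U').
  rewrite openE => y [Uy U'y]; apply: filterI; first exact: open_nbhs_nbhs.
  by apply: (Hf 0%N y Uy); exact: open_nbhs_nbhs.
exists (U `&` f @^-1` U'); split=> // r.
apply: (@Cr_comp _ _ _ _ _ _ U') => //; first by move=> y [].
by apply: Cr_sub (Hf r) => y [].
Qed.

Lemma smooth_row_mx V m n (f : V -> 'rV[R]_m) (g : V -> 'rV[R]_n) x :
  smooth f x -> smooth g x -> smooth (fun y => row_mx (f y) (g y)) x.
Proof.
move=> /smooth_coordP Hf /smooth_coordP Hg; apply/smooth_coordP => j.
under eq_fun do rewrite mxE; by case: (fintype.split _) => k.
Qed.

Lemma smooth_lsubmx V m n (f : V -> 'rV[R]_(m + n)) x :
  smooth f x -> smooth (fun y => lsubmx (f y)) x.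
Proof.
move=> /smooth_coordP Hf; apply/smooth_coordP => j.
under eq_fun do rewrite mxE; exact: Hf.
Qed.

Lemma smooth_rsubmx V m n (f : V -> 'rV[R]_(m + n)) x :
  smooth f x -> smooth (fun y => rsubmx (f y)) x.
Proof.
move=> /smooth_coordP Hf; apply/smooth_coordP => j.
under eq_fun do rewrite mxE; exact: Hf.
Qed.

Lemma is_derive_line V W (f : V -> W) (b w : V) (t : R) :
  differentiable f (t *: w + b) ->
  is_derive t 1 (fun t => f (t *: w + b)) ('D_w f (t *: w + b)).
Proof.
move=> df; have E : (fun h : R => h^-1 *: (((fun t => f (t *: w + b)) \o shift t) h%:A
      - f (t *: w + b))) =
    (fun h => h^-1 *: ((f \o shift (t *: w + b)) (h *: w) - f (t *: w + b))).
  by apply/funext => h /=; rewrite [h%:A]mulr1 scalerDl addrA.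
apply: DeriveDef; last by rewrite /derive E.
by rewrite /derivable E; exact: diff_derivable.
Qed.

Lemma mvt_line m (f : 'rV[R]_m -> R) (a b : 'rV[R]_m) :
  (forall t : R, 0 <= t <= 1 -> differentiable f (t *: (a - b) + b)) ->
  exists2 t : R, 0 <= t <= 1 & f a - f b = 'D_(a - b) f (t *: (a - b) + b).
Proof.
move=> df; pose g (t : R) : R := f (t *: (a - b) + b).
pose dgf (t : R) : R := 'D_(a - b) f (t *: (a - b) + b).
have dg (t : R) : t \in `[0, 1]%R -> is_derive t 1 g (dgf t).
  by rewrite in_itv /= => t01; apply: is_derive_line; exact: df.
have cg : {within `[0, 1], continuous g}.
  by apply: derivable_within_continuous => t /dg [].
have dg' (t : R) : t \in `]0, 1[%R -> is_derive t 1 g (dgf t) by move=> /subset_itv_oo_cc; exact: dg.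
have [t t01 E] := MVT_segment ler01 dg' cg.
move: E; rewrite /g /dgf scale1r subrK scale0r add0r subr0 mulr1 => E.
by exists t => //; move: t01; rewrite in_itv.
Qed.

(** On a small ball the partial derivatives stay within [e'] of their values at [x]; the mean value
    theorem is applied to each coordinate on the segment from [b] to [a]. The contraction and the
    injectivity below both rest on this two-point estimate. *)
Lemma strict_diff m n (f : 'rV[R]_m -> 'rV[R]_n) x : smooth f x ->
  forall e, 0 < e -> exists2 d, 0 < d & forall a b, `|a - x| < d -> `|b - x| < d ->
    `|f a - f b - 'd f x (a - b)| <= e * `|a - b|.
Proof.
move=> [U [oU Ux Hf]] e e0.
(* The sum over [m] partial derivatives costs a factor [m]; [m.+1] keeps the divisor nonzero for
   [m = 0]. *)
pose e' := e / m.+1%:R.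
have e'0 : 0 < e' by rewrite divr_gt0.
have : \forall y \near x, U y /\ forall j i,
    `|'D_(delta_mx 0 i) (fun y => f y 0 j) y - 'D_(delta_mx 0 i) (fun y => f y 0 j) x| < e'.
  apply: filterI; first exact: open_nbhs_nbhs.
  apply: (@filter_forall _ _ (fun j y => forall i, `|'D_(delta_mx 0 i) (fun y => f y 0 j) y -
    'D_(delta_mx 0 i) (fun y => f y 0 j) x| < e') _ (nbhs_filter x)) => j.
  apply: (@filter_forall _ _ (fun i y => `|'D_(delta_mx 0 i) (fun y => f y 0 j) y -
    'D_(delta_mx 0 i) (fun y => f y 0 j) x| < e') _ (nbhs_filter x)) => i.
  have [_ /(_ (delta_mx 0 i)) /(_ x Ux)] := Cr_coord 0 j oU (Hf 1%N).
  by move=> /cvgr_distC_lt; apply.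
move=> /nbhs_ballP[d d0 Hd]; exists d => // a b ax bx.
have seg (t : R) : 0 <= t <= 1 -> ball x d (t *: (a - b) + b).
  move=> /andP[t0 t1]; rewrite -ball_normE /= distrC.
  have -> : t *: (a - b) + b - x = t *: (a - x) + (1 - t) *: (b - x).
    by apply/rowP => i; rewrite !mxE; ring.
  apply: le_lt_trans (ler_normD _ _) _; rewrite !normrZ ger0_norm // ger0_norm ?subr_ge0 //.
  have : t * `|a - x| <= t * Num.max `|a - x| `|b - x| by rewrite ler_wpM2l // le_max lexx.
  have : (1 - t) * `|b - x| <= (1 - t) * Num.max `|a - x| `|b - x|.
    by rewrite ler_wpM2l ?subr_ge0 // le_max lexx orbT.
  have : Num.max `|a - x| `|b - x| < d by rewrite gt_max ax.
  lra.
apply: norm_le_coord => [|i j]; first by rewrite mulr_ge0 // ltW.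
rewrite ord1 {i}; pose fj y := f y 0 j.
have dfj y : U y -> differentiable fj y by move=> Uy; exact/differentiable_coordf/(Hf 1%N).1.
have dfx := (Hf 1%N).1 x Ux.
have [|t t01 E] := @mvt_line _ fj a b; first by move=> t /seg/Hd[Uy _]; exact: dfj.
have Dsum y : U y -> 'D_(a - b) fj y = \sum_i (a - b) 0 i * 'D_(delta_mx 0 i) fj y.
  move=> /dfj dy; rewrite deriveE // [X in 'd fj y X = _](row_sum_delta (a - b)) linear_sum.
  by apply: eq_bigr => i _; rewrite linearZ /= -deriveE.
have [Uy Dy] := Hd _ (seg t t01).
rewrite !mxE -[_ + - f b 0 j]/(fj a - fj b) E -(deriveE _ dfx) derive_mx; last exact: diff_derivable.
rewrite mxE -/fj !Dsum // -sumrB; apply: le_trans (ler_norm_sum _ _ _) _.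
apply: (@le_trans _ _ (\sum_(i < m) `|a - b| * e')).
  apply: ler_sum => i _; rewrite -mulrBr normrM ler_pM //; first exact: coord_norm_le.
  exact/ltW/Dy.
rewrite sumr_const card_ord -mulr_natr /e'.
have : m%:R / m.+1%:R <= 1 :> R by rewrite ler_pdivrMr // mul1r ler_nat.
have -> : `|a - b| * (e * m.+1%:R^-1) * m%:R = e * `|a - b| * (m%:R / m.+1%:R) by ring.
by apply: ler_piMr; rewrite mulr_ge0 // ltW.
Qed.

End Smooth.

HB.instance Definition _ (R : realType) m n := Complete.on 'M[R]_(m, n).

(** * The implicit function theorem *)

Section ImplicitFunction.
Context {R : realType}.

Lemma near_ball_norm (V : normedModType R) (x : V) (P : set V) :
  (\forall y \near x, P y) <-> exists2 d, 0 < d & forall y, `|y - x| < d -> P y.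
Proof.
split=> [/nbhs_ballP[d d0 H]|[d d0 H]].
  by exists d => // y yx; apply: H; rewrite -ball_normE /= distrC.
apply/nbhs_ballP; exists d => // y; rewrite -ball_normE /= distrC; exact: H.
Qed.

Lemma near_norm_lt (V : normedModType R) (x : V) (d : R) : 0 < d ->
  \forall y \near x, `|y - x| < d.
Proof. by move=> d0; apply/near_ball_norm; exists d. Qed.

(** If [f a = f b], the strict estimate with [e = 1/2] bounds the norm of [a - b] by half of
    itself. *)
Lemma locally_injective m (f : 'rV[R]_m -> 'rV[R]_m) x : smooth f x ->
  (forall w, 'd f x w = w) ->
  exists2 d, 0 < d & forall a b, `|a - x| < d -> `|b - x| < d -> f a = f b -> a = b.
Proof.
move=> sf dfx; have [|d d0 H] := strict_diff sf (e := 2^-1); first by rewrite invr_gt0.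
exists d => // a b ax bx fab; have := H a b ax bx.
rewrite dfx fab subrr sub0r normrN => ab.
apply/eqP; rewrite -subr_eq0 -normr_le0; have := normr_ge0 (a - b); lra.
Qed.

Lemma mulmx_lipschitz m n (A : 'M[R]_(m, n)) :
  exists2 K, 0 < K & forall u : 'rV[R]_m, `|u *m A| <= K * `|u|.
Proof. exact: (linear_lipschitz (@linear_row_continuous _ _ _ (mulmxr A))). Qed.

Lemma row_mx_split q p m (u : 'M[R]_(q, p)) (v : 'M[R]_(q, m)) :
  row_mx u v = u *m row_mx 1%:M 0 + v *m row_mx 0 1%:M.
Proof. by rewrite !mul_mx_row !mulmx1 !mulmx0 add_row_mx addr0 add0r. Qed.

Section Implicit.
Variables (p m : nat) (E : 'rV[R]_(p + m) -> 'rV[R]_p).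
Variables (T0 : 'rV[R]_p) (v0 : 'rV[R]_m).
Let y0 := row_mx T0 v0.
Hypothesis sE : smooth E y0.
Hypothesis dE : forall w, 'd E y0 (row_mx w 0) = w.

Let dEJ y (u : 'rV[R]_(p + m)) : 'd E y u = u *m 'J E y.
Proof. by symmetry; exact: mul_rV_lin1. Qed.

(** The Jacobian blocks for the unknown and for the parameter; with row vectors they are its upper
    and lower rows. *)
Let P y : 'M[R]_p := row_mx 1%:M 0 *m 'J E y.
Let Q y : 'M[R]_(m, p) := row_mx 0 1%:M *m 'J E y.

Let dEPQ y u v : 'd E y (row_mx u v) = u *m P y + v *m Q y.
Proof. by rewrite dEJ row_mx_split mulmxDl -!mulmxA. Qed.

Let Py0 : P y0 = 1%:M.
Proof.
by apply/row_matrixP => i; rewrite !rowE -[LHS]addr0 -(mul0mx _ (Q y0)) -dEPQ dE mulmx1.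
Qed.

Let Cr_J r U i j : open U -> Cr r.+1 U E -> Cr r U (fun y => ('J E y) i j).
Proof.
move=> oU [dfE DE]; apply: (@Cr_ext _ _ _ _ _ (fun y => ('D_(delta_mx 0 i) E y) 0 j)) => //.
  move=> y /dfE dy; rewrite deriveE //.
  by rewrite dEJ -rowE mxE.
exact: (Cr_coord _ _ oU (DE _)).
Qed.

Let Cr_P r U i j : open U -> Cr r.+1 U E -> Cr r U (fun y => P y i j).
Proof.
by move=> oU HE; apply: Cr_mulmx => // a b; [exact: Cr_cst|exact: Cr_J].
Qed.

Let Cr_Q r U i j : open U -> Cr r.+1 U E -> Cr r U (fun y => Q y i j).
Proof.
by move=> oU HE; apply: Cr_mulmx => // a b; [exact: Cr_cst|exact: Cr_J].
Qed.

Lemma implicit_neighborhood : exists2 d, 0 < d &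
  [/\ forall a b, `|a - y0| < d -> `|b - y0| < d ->
         `|E a - E b - 'd E y0 (a - b)| <= 2^-1 * `|a - b|,
      forall y, `|y - y0| < d -> P y \in unitmx &
      forall r, Cr r [set y | `|y - y0| < d] E].
Proof.
have [|d1 d10 H1] := strict_diff sE (e := 2^-1); first by rewrite invr_gt0.
have [U [oU Uy HE]] := sE.
have : \forall y \near y0, [/\ `|y - y0| < d1, U y & \det (P y) != 0].
  have cdet : {for y0, continuous (fun y => \det (P y))}.
    have : Cr 0 U (fun y => \det (P y)) by apply: Cr_det => // i j; exact: Cr_P.
    exact.
  have det0 : \det (P y0) = 1 by rewrite Py0 det1.
  have cdet1 : (fun y => \det (P y)) @ y0 --> (1 : R) by rewrite -det0; exact: cdet.
  have near1 : \forall y \near y0, `|y - y0| < d1 by apply: near_norm_lt.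
  have near2 : \forall y \near y0, U y by apply: open_nbhs_nbhs.
  have near3 : \forall y \near y0, \det (P y) != 0.
    move: cdet1 => /cvgr_distC_lt /(_ 1 ltr01); apply: filterS => y Hy.
    by apply/eqP => D0; move: Hy; rewrite D0 sub0r normrN normr1 ltxx.
  by apply: filterS3 near1 near2 near3 => y.
move=> /near_ball_norm[d d0 Hd]; exists d => //; split.
- by move=> a b /Hd[ad _ _] /Hd[bd _ _]; exact: H1.
- by move=> y /Hd[_ _ Dy]; rewrite unitmxE unitfE.
- by move=> r; apply: Cr_sub (HE r) => y /Hd[].
Qed.

Lemma open_norm_ball n (x : 'rV[R]_n) d : open [set y | `|y - x| < d].
Proof.
rewrite openE => y /= yd; suff : \forall z \near y, `|z - x| < d by [].
apply/near_ball_norm; exists (d - `|y - x|); first by rewrite subr_gt0.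
move=> z zy; have -> : z - x = (z - y) + (y - x) by rewrite addrA subrK.
by apply: le_lt_trans (ler_normD _ _) _; lra.
Qed.

Section Solve.
(** The hypotheses use the radius [d + d] because the norm of [row_mx] is bounded by the sum of the
    norms of its two parts, each at most [d]. *)
Variable d : R.
Hypothesis d0 : 0 < d.
Hypothesis strictE : forall a b, `|a - y0| < d + d -> `|b - y0| < d + d ->
  `|E a - E b - 'd E y0 (a - b)| <= 2^-1 * `|a - b|.
Hypothesis unitP : forall y, `|y - y0| < d + d -> P y \in unitmx.
Hypothesis CrE : forall r, Cr r [set y | `|y - y0| < d + d] E.

Let near_y0 T v : `|T - T0| <= d -> `|v - v0| < d -> `|row_mx T v - y0| < d + d.
Proof.
move=> Td vd; rewrite /y0 opp_row_mx add_row_mx.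
apply: le_lt_trans (norm_row_mx_le _ _) _; lra.
Qed.

Let contr v T T' : `|v - v0| < d -> `|T - T0| <= d -> `|T' - T0| <= d ->
  `|E (row_mx T v) - E (row_mx T' v) - (T - T')| <= 2^-1 * `|T - T'|.
Proof.
move=> vd Td Td'; have := strictE (near_y0 Td vd) (near_y0 Td' vd).
rewrite opp_row_mx add_row_mx subrr dE => H; apply: le_trans H _.
by rewrite ler_wpM2l ?invr_ge0 // norm_row_mxl0.
Qed.

Let solution_unique v T T' : `|v - v0| < d -> `|T - T0| <= d -> `|T' - T0| <= d ->
  E (row_mx T v) = E (row_mx T' v) -> T = T'.
Proof.
move=> vd Td Td' EE; have := contr vd Td Td'.
rewrite EE subrr sub0r normrN => H.
apply/eqP; rewrite -subr_eq0 -normr_le0; have := normr_ge0 (T - T'); lra.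
Qed.

(** Solutions are the fixed points of [f], which contracts by 1/2. It preserves the closed ball of
    radius [d]: one half of [d] comes from the contraction, the other from the bound on
    [E (row_mx T0 v) - E y0]. *)
Let solution_exists v : `|v - v0| < d -> `|E (row_mx T0 v) - E y0| <= d / 2 ->
  exists T, `|T - T0| <= d /\ E (row_mx T v) = E y0.
Proof.
move=> vd vE; pose B := [set T : 'rV[R]_p | `|T - T0| <= d].
pose f T := T - E (row_mx T v) + E y0.
have T0d : `|T0 - T0| <= d by rewrite subrr normr0 ltW.
have fB : {homo f : T / B T >-> B T}.
  move=> T /= Td; rewrite /B /f /=.
  have -> : T - E (row_mx T v) + E y0 - T0 =
    - (E (row_mx T v) - E (row_mx T0 v) - (T - T0)) - (E (row_mx T0 v) - E y0).
    by apply/rowP => i; rewrite !mxE; ring.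
  apply: le_trans (ler_normB _ _) _; rewrite normrN.
  have Td' : `|T - T0| <= d := Td.
  have := contr vd Td T0d; lra.
have [|||T BT fT] := @banach_fixed_point R _ B (mkfun fB).
- exists (2^-1)%:nng; split; first by rewrite /= invf_lt1 // ltr1n.
  move=> [T T'] /= [Td Td']; rewrite /f.
  have -> : T - E (row_mx T v) + E y0 - (T' - E (row_mx T' v) + E y0) =
    - (E (row_mx T v) - E (row_mx T' v) - (T - T')).
    by apply/rowP => i; rewrite !mxE; ring.
  by rewrite normrN; exact: contr.
- have -> : B = closed_ball T0 d.
    by rewrite closed_ballE //; apply/seteqP; split=> T; rewrite /B /closed_ball_ /= distrC.
  exact: closed_ball_closed.
- by exists T0; rewrite /B /= subrr normr0 ltW.
have fT' : T = T - E (row_mx T v) + E y0 := fT.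
exists T; split=> //; apply/rowP => i.
have := congr1 (fun x : 'rV[R]_p => x 0 i) fT'; rewrite !mxE; lra.
Qed.

Section Solution.
Variable eta : R.
Hypothesis eta0 : 0 < eta.
Hypothesis eta_d : forall v, `|v - v0| < eta ->
  `|v - v0| < d /\ `|E (row_mx T0 v) - E y0| <= d / 2.

(** Chosen separately for each [v], with default [T0] where there is no solution; its regularity
    must be extracted from the equation. *)
Let s v : 'rV[R]_p := xget T0 [set T | `|T - T0| <= d /\ E (row_mx T v) = E y0].

Let sP v : `|v - v0| < eta -> `|s v - T0| <= d /\ E (row_mx (s v) v) = E y0.
Proof.
move=> /eta_d[vd vE]; have [T HT] := solution_exists vd vE.
by rewrite /s; case: xgetP => [_ ->//|/(_ T)/(_ HT)].
Qed.

Let s_unique v T : `|v - v0| < eta -> `|T - T0| <= d -> E (row_mx T v) = E y0 -> T = s v.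
Proof.
move=> veta Td ET; have [sd sE'] := sP veta; have [vd _] := eta_d veta.
by apply: (solution_unique vd) => //; rewrite sE'.
Qed.

Let s_lipschitz : exists2 C, 0 < C & forall v v', `|v - v0| < eta -> `|v' - v0| < eta ->
  `|s v - s v'| <= C * `|v - v'|.
Proof.
have [K K0 HK] := mulmx_lipschitz (Q y0).
(* Write [ds], [dv] for the increments. [E] has equal values at both points, so [ds + dv *m Q y0]
   has norm at most [(|ds| + |dv|) / 2]; absorbing half of [|ds|] gives this constant. *)
exists (1 + 2 * K); first by rewrite addr_gt0 // mulr_gt0.
move=> v v' veta veta'; have [sd sE'] := sP veta; have [sd' sE''] := sP veta'.
have := strictE (near_y0 sd (eta_d veta).1) (near_y0 sd' (eta_d veta').1).
rewrite sE' sE'' subrr sub0r normrN opp_row_mx add_row_mx dEPQ Py0 mulmx1.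
have := norm_row_mx_le (s v - s v') (v - v').
have := HK (v - v'); have := ler_normB (s v - s v' + (v - v') *m Q y0) ((v - v') *m Q y0).
rewrite addrK; lra.
Qed.

(** Implicit differentiation, at all points near [v0] because [Cr_s] needs the formula on an open
    set. The Lipschitz bound turns an error small against the whole increment [u] into one small
    against [h]. *)
Let s_diff v : `|v - v0| < eta -> differentiable s v /\
  forall h, 'd s v h = - (h *m Q (row_mx (s v) v) *m invmx (P (row_mx (s v) v))).
Proof.
move=> veta; set y := row_mx (s v) v.
have [C C0 HC] := s_lipschitz.
have [sd sE'] := sP veta; have yd := near_y0 sd (eta_d veta).1.
have Ey : differentiable E y by exact: (CrE 1).1.
have uP : P y \in unitmx by exact: unitP.
have [K K0 HK] := mulmx_lipschitz (invmx (P y)).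
pose L : {linear 'rV[R]_m -> 'rV[R]_p} := mulmxr (- (Q y *m invmx (P y))).
have [||ds dsL] := @eps_differentiable R _ _ s v L.
- exact: linear_row_continuous.
(* [C + 1] bounds the ratio of [u] to [h] in norm, and [K] is the bound for [invmx (P y)]. *)
- move=> e e0; have e'0 : 0 < e / (K * (C + 1)) by rewrite divr_gt0 // mulr_gt0 // addr_gt0.
  have /near_ball_norm[r r0 Hr] := differentiable_eps Ey e'0.
  have n1 : \forall h \near (0 : 'rV[R]_m), `|h - 0| < r / (C + 1).
    by apply: near_norm_lt; rewrite divr_gt0 // addr_gt0.
  have n2 : \forall h \near (0 : 'rV[R]_m), `|h - 0| < eta - `|v - v0|.
    by apply: near_norm_lt; rewrite subr_gt0.
  apply: filterS2 n1 n2 => h; rewrite subr0 => hr heta.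
  have hv : `|h + v - v0| < eta.
    by rewrite -addrA; apply: le_lt_trans (ler_normD _ _) _; lra.
  have [sd' sE''] := sP hv.
  pose u := row_mx (s (h + v) - s v) h.
  have uC : `|u| <= (C + 1) * `|h|.
    apply: le_trans (norm_row_mx_le _ _) _; rewrite mulrDl mul1r lerD2r.
    by have := HC _ _ hv veta; rewrite addrK.
  have uy : u + y = row_mx (s (h + v)) (h + v) by rewrite /u /y add_row_mx subrK.
  have := Hr u; rewrite subr0 uy sE'' sE' subrr sub0r normrN => uE0.
  have {uE0} uE : `|'d E y u| <= e / (K * (C + 1)) * `|u|.
    apply: uE0; apply: le_lt_trans uC _.
    by rewrite mulrC -ltr_pdivlMr // addr_gt0.
  rewrite dEPQ in uE.
  have -> : s (h + v) - s v - L h =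
      ((s (h + v) - s v) *m P y + h *m Q y) *m invmx (P y).
    by rewrite /L /= mulmxDl mulmxK // mulmxN opprK mulmxA.
  apply: le_trans (HK _) _; have uE' := uE.
  have -> : e * `|h| = K * (e / (K * (C + 1)) * ((C + 1) * `|h|)).
    have C1 : C + 1 != 0 by rewrite gt_eqF // addr_gt0.
    by field; rewrite C1 gt_eqF.
  rewrite ler_wpM2l ?(ltW K0) //; apply: le_trans uE' _; by rewrite ler_wpM2l // ltW.
- by split=> // h; rewrite dsL /L /= mulmxN mulmxA.
Qed.

(** Bootstrapping: the derivative of [s] is a smooth expression [G] in [s v] and [v], so order [r]
    for [s] gives order [r] for its derivative. *)
Let Cr_s r : Cr r [set v | `|v - v0| < eta] s.
Proof.
have oW := @open_norm_ball _ v0 eta; have oY := @open_norm_ball _ y0 (d + d).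
elim: r => [|r IH].
  move=> v veta; have [C C0 HC] := s_lipschitz.
  apply/(@cvgrPdist_lt _ _ _ (nbhs v) (nbhs_filter v)) => e e0.
  have n1 : \forall h \near v, `|h - v| < e / C by apply: near_norm_lt; rewrite divr_gt0.
  have n2 : \forall h \near v, `|h - v0| < eta by exact: open_nbhs_nbhs.
  apply: filterS2 n1 n2 => h hv heta; apply: le_lt_trans (HC _ _ veta heta) _.
  by rewrite distrC mulrC -ltr_pdivlMr.
split=> [v veta|w]; first by case: (s_diff veta).
pose G y : 'rV[R]_p := - (w *m Q y *m invmx (P y)).
apply: (@Cr_ext _ _ _ _ _ (fun v => G (row_mx (s v) v))) => //.
  by move=> v veta; have [ds dsE] := s_diff veta; rewrite deriveE // dsE.
have CrG : Cr r [set y | `|y - y0| < d + d] G.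
  apply: CrN => //; apply/Cr_coordP => // j; apply: Cr_mulmx => // a b.
    apply: Cr_mulmx => // a' b'; first exact: Cr_cst.
    exact: Cr_Q.
  by apply: Cr_invmx => // i' j'; exact: Cr_P.
apply: (@Cr_comp _ _ _ _ _ _ _ G (fun v => row_mx (s v) v) oW oY _ _ CrG) => [v /= veta|].
  by apply: near_y0; [exact: (sP veta).1|exact: (eta_d veta).1].
apply/Cr_coordP => // j.
have -> : (fun v => row_mx (s v) v 0 j) =
    (fun v => match fintype.split j with inl k => s v 0 k | inr k => v 0 k end).
  by apply/funext => v; rewrite mxE.
case: (fintype.split j) => k; first exact: Cr_coord.
by apply: Cr_coord => //; apply: (@Cr_lin _ _ _ _ _ idfun) => x.
Qed.

Lemma implicit_function_aux : exists s : 'rV[R]_m -> 'rV[R]_p,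
  [/\ s v0 = T0, smooth s v0,
      \forall v \near v0, E (row_mx (s v) v) = E y0 &
      \forall v \near v0, forall T, `|T - T0| < d -> E (row_mx T v) = E y0 -> T = s v].
Proof.
have v0eta : `|v0 - v0| < eta by rewrite subrr normr0.
exists s; split.
- by apply/esym/s_unique => //; rewrite subrr normr0 ltW.
- by exists [set v | `|v - v0| < eta]; split=> //; exact: open_norm_ball.
- by apply/near_ball_norm; exists eta => // v /sP[].
- by apply/near_ball_norm; exists eta => // v veta T /ltW; exact: s_unique.
Qed.

End Solution.
End Solve.

(** The last clause excludes other solutions within a radius independent of [v]; [local_time] uses
    it to compare the reaching times of two points of one orbit. *)
Lemma implicit_function : exists2 d, 0 < d & exists s : 'rV[R]_m -> 'rV[R]_p,
  [/\ s v0 = T0, smooth s v0,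
      \forall v \near v0, E (row_mx (s v) v) = E y0 &
      \forall v \near v0, forall T, `|T - T0| < d -> E (row_mx T v) = E y0 -> T = s v].
Proof.
have [d1 d10 [H1 H2 H3]] := implicit_neighborhood; pose d := d1 / 2.
have d0 : 0 < d by rewrite divr_gt0.
have dd : d1 = d + d by rewrite /d -splitr.
rewrite dd in H1 H2 H3.
exists d => //.
have cE : {for v0, continuous (fun v => E (row_mx T0 v))}.
  apply: smooth_continuous; apply: (@smooth_comp _ _ _ _ E (fun v => row_mx T0 v)) => //.
  by apply: smooth_row_mx; [exact: smooth_cst|exact: smooth_id].
have n1 : \forall v \near v0, `|v - v0| < d by exact: near_norm_lt.
have n2 : \forall v \near v0, `|E (row_mx T0 v) - E y0| < d / 2.
  by move: cE => /cvgr_distC_lt; apply; rewrite divr_gt0.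
have /near_ball_norm[eta eta0 Heta] : \forall v \near v0,
    `|v - v0| < d /\ `|E (row_mx T0 v) - E y0| <= d / 2.
  by apply: filterS2 n1 n2 => v ? /ltW.
exact: (implicit_function_aux d0 H1 H2 H3 eta0 Heta).
Qed.

End Implicit.
End ImplicitFunction.

(** * Local structure of the action *)

Section LinearAlgebra.
Context {F : fieldType}.

(** Meant for [X] the generators of the action, [A] the differential of the integrals and [L] a
    slice coordinate. The row space of [X] lies in the kernel of [A] and has the same dimension [n],
    so they agree; a vector killed by [A] and [L] is then [w *m X] with [w = w *m X *m L = 0]. *)
Lemma complementary_left_inverse n k (X : 'M[F]_(n, k + n)) (A : 'M[F]_(k + n, k))
    (L : 'M[F]_(k + n, n)) :
  X *m A = 0 -> X *m L = 1%:M -> row_full A ->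
  exists D, row_mx A L *m D = 1%:M.
Proof.
move=> XA XL Afull; apply/row_freeP; rewrite -kermx_eq0; apply/eqP/row_matrixP => i.
rewrite row0; set u := row i _.
have : u *m row_mx A L = 0 by rewrite /u -row_mul mulmx_ker row0.
rewrite mul_mx_row => /eqP; rewrite row_mx_eq0 => /andP[/eqP uA /eqP uL].
have rX : \rank X = n by apply/eqP; apply/row_freeP; exists L.
have Xker : (X <= kermx A)%MS by apply/sub_kermxP.
have kerX : (kermx A <= X)%MS.
  rewrite -(mxrank_leqif_sup Xker) mxrank_ker rX.
  by move: Afull; rewrite /row_full => /eqP ->; rewrite addKn.
have /submxP[w uE] : (u <= X)%MS by apply: submx_trans kerX; apply/sub_kermxP.
by move: uL; rewrite uE -mulmxA XL mulmx1 => ->; rewrite mul0mx.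
Qed.

End LinearAlgebra.

Section Derivatives.
Context {R : realType}.

Lemma derive_near_const (V W : normedModType R) (f : V -> W) a v :
  (\forall h \near (0 : R), f (h *: v + a) = f a) -> 'D_v f a = 0.
Proof.
move=> H; rewrite /derive; apply: cvg_lim => //.
apply: cvg_near_cst; apply: cvg_within; apply: filterS H => h /= ->.
by rewrite subrr scaler0.
Qed.

Lemma derive0_constant n (g : R -> 'rV[R]_n) (d : R) : 0 < d ->
  (forall t : R, `|t| < d -> is_derive t 1 g 0) -> forall t : R, `|t| < d -> g t = g 0.
Proof.
move=> d0 dg t td; apply/rowP => j.
have dgj (u : R) : `|u| < d -> is_derive u 1 (fun u => g u 0 j) 0.
  move=> /dg[dgu gu0]; apply: DeriveDef; first by have /derivable_mxP/(_ 0 j) := dgu.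
  by have := derive_mx dgu; rewrite gu0 => /(congr1 (fun M : 'rV[R]_n => M 0 j)); rewrite !mxE.
have aux (a b : R) : a <= b -> `|a| < d -> `|b| < d -> g a 0 j = g b 0 j.
  move=> ab ad bd.
  have seg u : u \in `[a, b]%R -> `|u| < d.
    rewrite in_itv /= => /andP[au ub]; rewrite ltr_norml.
    by move: ad bd; rewrite !ltr_norml => /andP[? ?] /andP[? ?]; lra.
  have dgj' (u : R) : u \in `]a, b[%R -> is_derive u 1 (fun u => g u 0 j) ((fun=> 0) u).
    by move=> /subset_itv_oo_cc/seg/dgj.
  have cgj : {within `[a, b], continuous (fun u => g u 0 j)}.
    by apply: derivable_within_continuous => u /seg/dgj[].
  have [u _ /eqP] := MVT_segment ab dgj' cgj.
  by rewrite mul0r subr_eq0 => /eqP.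
have z : `|0 : R| < d by rewrite normr0.
by case: (leP 0 t) => [t0|/ltW t0]; [symmetry|]; exact: aux.
Qed.

End Derivatives.

Section Chart.
Context {R : realType} {d : nat} (M : manifold R d).
Variables (c : chart R M d) (x : M).
Hypothesis cA : atlas M c.
Hypothesis xc : chart_dom c x.

Let chartc : is_chart c := let: And3 H _ _ := atlasP M in H c cA.

Lemma chart_mapK y : chart_dom c y -> chart_inv c (c y) = y.
Proof. by have [_ _ _ _] := chartc; apply. Qed.

Lemma near_chart_dom : \forall y \near x, chart_dom c y.
Proof. by have [oc _ _ _ _] := chartc; exact: open_nbhs_nbhs. Qed.

Lemma near_chart_cod : \forall v \near c x, chart_cod c v.
Proof. by have [_ oc _ _ _] := chartc; apply: open_nbhs_nbhs; split=> //; exists x. Qed.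

Lemma chart_invK v : chart_cod c v -> c (chart_inv c v) = v.
Proof. by move=> [y yc <-]; rewrite chart_mapK. Qed.

Lemma chart_continuous : {for x, continuous c}.
Proof.
have [oc _ cc _ _] := chartc.
by have := cc; rewrite continuous_open_subspace // => /(_ x (mem_set xc)).
Qed.

Lemma chart_inv_continuous_at v : chart_cod c v -> {for v, continuous (chart_inv c)}.
Proof.
move=> vc; have [_ oc _ cc _] := chartc.
by have := cc; rewrite continuous_open_subspace // => /(_ v (mem_set vc)).
Qed.

Lemma chart_inv_continuous : chart_inv c v @[v --> c x] --> x.
Proof.
have xv : chart_cod c (c x) by exists x.
by have := chart_inv_continuous_at xv; rewrite /prop_for /continuous_at chart_mapK.
Qed.

Lemma near_chart (P : set 'rV[R]_d) : (\forall v \near c x, P v) -> \forall y \near x, P (c y).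
Proof. exact: chart_continuous. Qed.

Lemma near_chart_inv (P : set M) : (\forall y \near x, P y) -> \forall v \near c x, P (chart_inv c v).
Proof. exact: chart_inv_continuous. Qed.

End Chart.

(** * The action in a chart and the time needed to reach a slice *)

Section LocalTime.
Context {R : realType} {k n : nat} (S : integrable_system R k n).
Variables (c : chart R S (k + n)) (x0 : S).
Hypothesis cA : atlas S c.
Hypothesis x0c : chart_dom c x0.
Let v0 := c x0.

Lemma flow_continuous : continuous (fun p : 'rV[R]_n * S => flow S p.1 p.2).
Proof. exact: (flow_smooth S).1. Qed.

Lemma flow_continuous2 (V : topologicalType) (T : V -> 'rV[R]_n) (y : V -> S) v :
  {for v, continuous T} -> {for v, continuous y} ->
  {for v, continuous (fun v => flow S (T v) (y v))}.
Proof.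
move=> cT cy; apply: (@continuous_comp _ _ _ (fun v => (T v, y v)) (fun p => flow S p.1 p.2)).
  exact: (@cvg_pair _ _ _ (nbhs v) _ _ (nbhs_filter _) (nbhs_filter _) (nbhs_filter _)).
exact: flow_continuous.
Qed.

Lemma flowK T (x : S) : flow S (- T) (flow S T x) = x.
Proof. by rewrite -flowD addNr flow0. Qed.

Definition flow_chart (c c' : chart R S (k + n)) (u : 'rV[R]_(n + (k + n))) :=
  c' (flow S (lsubmx u) (chart_inv c (rsubmx u))).

Lemma flow_chart_smooth c' T x : atlas S c' -> chart_dom c x -> chart_dom c' (flow S T x) ->
  smooth (flow_chart c c') (row_mx T (c x)).
Proof.
move=> c'A xc Txc'; apply/smooth_atE.
apply: ((flow_smooth S).2 (prod_chart (Chart setT id id) c) c' (T, x)) => //.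
by exists (Chart setT id id) => //; exists c.
Qed.

Lemma flow_chartE c' T x : chart_dom c x ->
  flow_chart c c' (row_mx T (c x)) = c' (flow S T x).
Proof. by move=> xc; rewrite /flow_chart row_mxKl row_mxKr (chart_mapK cA). Qed.

Let F' := @fintegrals _ _ _ S \o chart_inv c.

Let F'_smooth x : chart_dom c x -> smooth F' (c x).
Proof.
move=> xc; apply/smooth_atE.
exact: ((fintegrals_smooth S).2 c (Chart setT id id) x).
Qed.

Let phi := flow_chart c c.
Let phi_smooth T : chart_dom c (flow S T x0) -> smooth phi (row_mx T v0).
Proof. exact: flow_chart_smooth. Qed.

Let phi0_smooth : smooth phi (row_mx 0 v0).
Proof. by apply: phi_smooth; rewrite flow0. Qed.

Let J0 := 'J phi (row_mx 0 v0).
(** Its rows are the generators of the action at [x0], read in the chart. *)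
Let X : 'M[R]_(n, k + n) := row_mx 1%:M 0 *m J0.
Let A := 'J F' v0.

Let dphi w : 'd phi (row_mx 0 v0) (row_mx w 0) = w *m X.
Proof.
rewrite /X mulmxA mul_mx_row mulmx1 mulmx0.
by symmetry; exact: mul_rV_lin1.
Qed.

Let dF' u : 'd F' v0 u = u *m A.
Proof. by symmetry; exact: mul_rV_lin1. Qed.

Let line_continuous (w : 'rV[R]_n) (t : R) : {for t, continuous (fun h : R => flow S (h *: w) x0)}.
Proof. by apply: flow_continuous2; [exact: scalel_continuous|exact: cst_continuous]. Qed.

Let line_near (w : 'rV[R]_n) : \forall h \near (0 : R), chart_dom c (flow S (h *: w) x0).
Proof.
have := @line_continuous w 0; rewrite /prop_for /continuous_at scale0r flow0.
by apply; exact: near_chart_dom.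
Qed.

Let row_line h w T : h *: row_mx w 0 + row_mx T v0 = row_mx (h *: w + T) v0 :> 'rV[R]_(n + (k + n)).
Proof. by rewrite scale_row_mx scaler0 add_row_mx add0r. Qed.

Let XA : X *m A = 0.
Proof.
apply/row_matrixP => i; rewrite row0 rowE mulmxA -dphi -dF'; set w := delta_mx _ _.
have phi0 : phi (row_mx 0 v0) = v0 by rewrite /phi flow_chartE // flow0.
have dF'0 : differentiable F' (phi (row_mx 0 v0)).
  by rewrite phi0; exact/smooth_differentiable/F'_smooth.
have dphi0 := smooth_differentiable phi0_smooth.
rewrite -[in 'd F' _]phi0 -[LHS]/(('d F' (phi (row_mx 0 v0)) \o 'd phi (row_mx 0 v0)) _).
rewrite -diff_comp // -deriveE; last exact: differentiable_comp.
apply: derive_near_const; apply: filterS (line_near w) => h hc.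
rewrite row_line addr0 /F' /= /phi !flow_chartE // (chart_mapK cA) // (chart_mapK cA).
  by rewrite !fintegrals_flow.
by rewrite flow0.
Qed.

(** By the group law, [phi (row_mx ((h + t) *: w) v0) = psi (phi (row_mx (h *: w) v0))] for small
    [h], with [psi] the flow at time [t *: w]. So the velocity at time [t] is the image of the
    velocity at time 0, which vanishes, under the differential of [psi]. *)
Let line_derive w : w *m X = 0 -> forall t : R, chart_dom c (flow S (t *: w) x0) ->
  is_derive t 1 (fun t => phi (row_mx (t *: w) v0)) 0.
Proof.
move=> wX t tc; have sphit := phi_smooth tc.
have row_line0 (h : R) : h *: row_mx w 0 + row_mx 0 v0 = row_mx (h *: w) v0 :> 'rV[R]_(n + (k + n)).
  by rewrite row_line addr0.
have -> : (fun t => phi (row_mx (t *: w) v0)) = (fun t => phi (t *: row_mx w 0 + row_mx 0 v0)).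
  by apply/funext => h; rewrite row_line0.
have D0 : 'D_(row_mx w 0) phi (t *: row_mx w 0 + row_mx 0 v0) = 0.
  rewrite row_line0; pose psi v := phi (row_mx (t *: w) v).
  have phi0 : phi (row_mx 0 v0) = v0 by rewrite /phi flow_chartE // flow0.
  have spsi : smooth psi v0.
    apply: (@smooth_comp _ _ _ _ phi (fun v => row_mx (t *: w) v)) => //.
    by apply: smooth_row_mx; [exact: smooth_cst|exact: smooth_id].
  have dpsi : differentiable psi (phi (row_mx 0 v0)).
    by rewrite phi0; exact: smooth_differentiable.
  have dphi0 := smooth_differentiable phi0_smooth.
  have : 'D_(row_mx w 0) (psi \o phi) (row_mx 0 v0) = 0.
    rewrite deriveE; last exact: differentiable_comp.
    by rewrite diff_comp // -[LHS]/('d psi _ ('d phi _ _)) dphi wX linear0.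
  move=> D0'; rewrite -[RHS]D0' /derive; congr (lim _).
  have E : {near (0 : R)^', (fun h => h^-1 *: (((psi \o phi) \o shift (row_mx 0 v0)) (h *: row_mx w 0)
             - (psi \o phi) (row_mx 0 v0))) =1
    (fun h => h^-1 *: ((phi \o shift (row_mx (t *: w) v0)) (h *: row_mx w 0) - phi (row_mx (t *: w) v0)))}.
    apply: cvg_within; apply: filterS (line_near w) => h hc /=.
    rewrite row_line0 row_line /psi phi0 {2}/phi (flow_chartE _ _ x0c) /phi.
    by rewrite !flow_chartE // -flowD [t *: w + _]addrC.
  rewrite eqEsubset; split; apply: near_eq_cvg; apply: filterS E => h Eh.
    exact: (esym Eh).
  exact: Eh.
have := @is_derive_line _ _ _ phi (row_mx 0 v0) (row_mx w 0) t.
rewrite D0; apply; rewrite row_line0.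
exact: smooth_differentiable.
Qed.

(* The isotropy is discrete, so the orbit map cannot be stationary in the
   direction [w]; no uniqueness theorem for differential equations is needed,
   because [line_derive] transports a zero derivative along the orbit. *)
Let X_injective (w : 'rV[R]_n) : w *m X = 0 -> w = 0.
Proof.
move=> wX; have /near_ball_norm[d d0 Hd] := line_near w.
have const (t : R) : `|t| < d -> flow S (t *: w) x0 = x0.
  move=> td; have tc : chart_dom c (flow S (t *: w) x0) by apply: Hd; rewrite subr0.
  have dg (u : R) : `|u| < d -> is_derive u 1 (fun u => phi (row_mx (u *: w) v0)) 0.
    by move=> ud; apply: (line_derive wX); apply: Hd; rewrite subr0.
  have := derive0_constant d0 dg td.
  rewrite scale0r /phi !flow_chartE // flow0 => H.
  by rewrite -(chart_mapK cA tc) H (chart_mapK cA).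
have : isolated (isotropy (flow S) x0) 0.
  by rewrite flow_locally_free /isotropy /= flow0.
move=> [_ [V V0 VE]].
have cw : (fun h : R => h *: w) h @[h --> (0 : R)] --> (0 : 'rV[R]_n).
  by rewrite -[X in _ --> X](scale0r w); exact: scalel_continuous.
have /near_ball_norm[e e0 He] := cw _ V0.
pose t := Num.min d e / 2.
have t0 : 0 < t by rewrite divr_gt0 // lt_min d0.
have tmin : t < Num.min d e by rewrite ltr_pdivrMr // ltr_pMr ?ltr1n // lt_min d0.
have [td te] : t < d /\ t < e by move: tmin; rewrite lt_min => /andP[].
have : (V `&` isotropy (flow S) x0) (t *: w).
  split; first by apply: He; rewrite subr0 gtr0_norm.
  by rewrite /isotropy /=; apply: const; rewrite gtr0_norm.
by rewrite VE /= => /eqP; rewrite scaler_eq0 gt_eqF // => /eqP.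
Qed.

Let A_full : row_full A.
Proof.
have [B HB] := choice (fun i : 'I_k => fintegrals_submersion cA x0c (delta_mx 0 i)).
apply/row_fullP; exists (\matrix_i B i).
by apply/row_matrixP => i; rewrite row_mul rowK -dF' HB row1.
Qed.

(* Near [x0] the action moves along orbits as translation moves the time
   [s]; [- s y] is the time at which [y] reaches a slice [v *m L = v0 *m L]. *)
Lemma local_time : exists s : S -> 'rV[R]_n,
  [/\ smooth (s \o chart_inv c) v0, s x0 = 0,
   exists2 V, nbhs x0 V & forall y y', V y -> V y' -> fintegrals y = fintegrals y' ->
      y' = flow S (s y' - s y) y &
   exists2 e, 0 < e & \forall y \near x0, forall T, `|T| < e -> s (flow S T y) = s y + T].
Proof.
have [L XL] : exists L, X *m L = 1%:M.
  apply/row_freeP; rewrite -kermx_eq0; apply/eqP/row_matrixP => i.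
  by rewrite row0; apply: X_injective; rewrite -row_mul mulmx_ker row0.
have [D ALD] := complementary_left_inverse XA XL A_full.
have phi0 : phi (row_mx 0 v0) = v0 by rewrite /phi flow_chartE // flow0.
have smulr m p (B : 'M[R]_(m, p)) v : smooth (fun v : 'rV[R]_m => v *m B) v.
  exact: (smooth_linrV (mulmxr B)).
have dmulr m p (B : 'M[R]_(m, p)) v w : 'd (fun v : 'rV[R]_m => v *m B) v w = w *m B.
  exact: (congr1 (fun f => f w) (diff_lin v (@linear_row_continuous _ _ _ (mulmxr B)))).
have [dinj dinj0 Ginj] : exists2 d, 0 < d & forall a b, `|a - v0| < d -> `|b - v0| < d ->
    F' a = F' b -> a *m L = b *m L -> a = b.
  (* [G] depends on [v] only through [F' v] and [v *m L], and [D] is chosen so that its differential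
     at [v0] is the identity; hence [locally_injective] applies. *)
  pose G v := F' v *m (row_mx 1%:M 0 *m D) + v *m (L *m (row_mx 0 1%:M *m D)).
  have sG1 : smooth (fun v => F' v *m (row_mx 1%:M 0 *m D)) v0.
    apply: (@smooth_comp _ _ _ _ (fun u => u *m (row_mx 1%:M 0 *m D))); last exact: smulr.
    exact: F'_smooth.
  have dG w : 'd G v0 w = w.
    have dF0 := smooth_differentiable (F'_smooth x0c).
    have d1 : 'd (fun v => F' v *m (row_mx 1%:M 0 *m D)) v0 w = w *m A *m (row_mx 1%:M 0 *m D).
      have dmul := smooth_differentiable (smulr _ _ (row_mx 1%:M 0 *m D) (F' v0)).
      apply: etrans (congr1 (fun f => f w) (diff_comp dF0 dmul)) _.
      exact: etrans (dmulr _ _ _ _ _) (congr1 (fun u => u *m _) (dF' w)).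
    have d2 := dmulr _ _ (L *m (row_mx 0 1%:M *m D)) v0 w.
    have df1 := smooth_differentiable sG1.
    have df2 := smooth_differentiable (smulr _ _ (L *m (row_mx 0 1%:M *m D)) v0).
    apply: etrans (congr1 (fun f => f w) (diffD df1 df2)) _.
    apply: etrans (congr2 +%R d1 d2) _.
    transitivity (w *m (row_mx A L *m D)); last by rewrite ALD mulmx1.
    by rewrite [row_mx A L]row_mx_split mulmxDl mulmxDr !mulmxA.
  have [|d d0 Gi] := @locally_injective _ _ G v0 _ dG; first exact: smoothD.
  exists d => // a b ad bd Fab Lab; apply: Gi => //.
  by rewrite /G Fab !(mulmxA _ L) Lab.
(* The slice coordinate after a given time; the solution [s'] is the time that brings a point into
   the slice through [v0]. *)
pose E u := phi u *m L.
have sE : smooth E (row_mx 0 v0).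
  by apply: (@smooth_comp _ _ _ _ (fun u => u *m L)) => //; exact: smulr.
have dE w : 'd E (row_mx 0 v0) (row_mx w 0) = w.
  have dmul : differentiable (fun v => v *m L) (phi (row_mx 0 v0)).
    exact/smooth_differentiable/smulr.
  rewrite (diff_comp (smooth_differentiable phi0_smooth) dmul) /= dphi.
  by rewrite dmulr -mulmxA XL mulmx1.
have [d d0 [s' [s'0 ss' s'E s'uniq]]] := implicit_function sE dE.
have cs' : {for x0, continuous (fun y => s' (c y))}.
  apply: continuous_comp; first exact: (chart_continuous cA x0c).
  exact: smooth_continuous.
(* Projection to the slice along orbits. By [Ginj], points near [x0] with equal integrals have the
   same projection, so they differ by the difference of their reaching times. *)
pose z y := flow S (s' (c y)) y.
have cz : {for x0, continuous z}.
  by apply: flow_continuous2 => //; exact: cvg_id.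
have z0 : z x0 = x0 by rewrite /z s'0 flow0.
have cz0 : z y @[y --> x0] --> x0 by rewrite -[X in _ --> X]z0; exact: cz.
have domx0 := near_chart_dom cA x0c.
exists (fun y => - s' (c y)); split.
- apply: (@smooth_ext _ _ _ (fun v => - s' v)); last exact: smoothN.
  by apply: filterS (near_chart_cod cA x0c) => v vc /=; rewrite (chart_invK cA).
- by rewrite -/v0 s'0 oppr0.
- exists [set y | [/\ chart_dom c y, chart_dom c (z y), `|c (z y) - v0| < dinj & c (z y) *m L = v0 *m L]].
    have n2 : \forall y \near x0, chart_dom c (z y) := cz0 _ domx0.
    have n3 : \forall y \near x0, `|c (z y) - v0| < dinj.
      exact: (cz0 [set y | `|c y - v0| < dinj] (near_chart cA x0c (near_norm_lt _ dinj0))).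
    have n4 := near_chart cA x0c s'E.
    have n12 : \forall y \near x0, chart_dom c y /\ chart_dom c (z y).
      by apply: filterS2 domx0 n2.
    apply: filterS3 n12 n3 n4 => y [yc zyc] zd; rewrite /E phi0 /phi flow_chartE //.
  move=> y y' [yc zyc zyd zyL] [yc' zyc' zyd' zyL'] FF.
  have zz : z y = z y'.
    rewrite -(chart_mapK cA zyc) -(chart_mapK cA zyc'); congr (chart_inv c _).
    apply: Ginj => //; last by rewrite zyL.
    by rewrite /F' /= !(chart_mapK cA) // /z !fintegrals_flow.
  by rewrite opprK flowD -/(z y) zz /z flowK.
(* The time [s' (c y) - T] also brings [flow S T y] into the slice. Both terms are below [d / 2], so
   it lies within the radius of uniqueness and is the reaching time of [flow S T y]. *)
- have d20 : 0 < d / 2 by rewrite divr_gt0.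
  pose uniq y := forall T, `|T - 0| < d -> E (row_mx T (c y)) = E (row_mx 0 v0) -> T = s' (c y).
  have nu : \forall y \near flow S 0 x0, chart_dom c y /\ uniq y.
    by rewrite flow0; apply: filterS2 domx0 (near_chart cA x0c s'uniq).
  have [[B1 B2] /= [nB1 nB2] B12] := @flow_continuous (0, x0) _ nu.
  have /near_ball_norm[e e0 He] := nB1.
  exists (Num.min e (d / 2)); first by rewrite lt_min e0.
  have n1 : \forall y \near x0, `|s' (c y)| < d / 2.
    by move: cs' => /cvgr_distC_lt /(_ (d / 2) d20); rewrite s'0; apply: filterS => y; rewrite subr0.
  have n4 := near_chart cA x0c s'E.
  have n12 : \forall y \near x0, B2 y /\ chart_dom c y by apply: filterS2 nB2 domx0.
  apply: filterS3 n12 n1 n4 => y [yB2 yc] ys' yE T; rewrite lt_min => /andP[Te Td].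
  have [/= Tyc uniqTy] : chart_dom c (flow S T y) /\ uniq (flow S T y).
    by apply: (B12 (T, y)); split=> //; apply: He; rewrite subr0.
  have sT : s' (c y) - T = s' (c (flow S T y)).
    apply: uniqTy.
      by rewrite subr0; apply: le_lt_trans (ler_normB _ _) _; rewrite (splitr d) ltrD.
    by rewrite -yE /E /phi !flow_chartE // -flowD subrK.
  by rewrite -sT opprB addrC.
Qed.

End LocalTime.

(** * Isotropy lattices *)

Section Isotropy.
Context {R : realType} {k n : nat} (S : integrable_system R k n).
Implicit Types (x y : S) (T U : 'rV[R]_n).

Lemma isotropy0 x : isotropy (flow S) x 0.
Proof. exact: flow0. Qed.

Lemma isotropyD x T U : isotropy (flow S) x T -> isotropy (flow S) x U ->
  isotropy (flow S) x (T + U).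
Proof. by rewrite /isotropy /= flowD => Tx ->. Qed.

Lemma isotropyN x T : isotropy (flow S) x T -> isotropy (flow S) x (- T).
Proof. by rewrite /isotropy /= => Tx; rewrite -{1}Tx flowK. Qed.

Lemma isotropyB x T U : isotropy (flow S) x T -> isotropy (flow S) x U ->
  isotropy (flow S) x (T - U).
Proof. by move=> Tx Ux; apply: isotropyD => //; exact: isotropyN. Qed.

Lemma isotropyMz x T (a : int) : isotropy (flow S) x T -> isotropy (flow S) x (T *~ a).
Proof.
move=> Tx; have H (m : nat) : isotropy (flow S) x (T *+ m).
  elim: m => [|m IH]; first by rewrite mulr0n; exact: isotropy0.
  by rewrite mulrS; exact: isotropyD.
by case: a => m; [exact: H|rewrite NegzE mulrNz; exact/isotropyN/H].
Qed.

Lemma isotropy_flow x T U : isotropy (flow S) (flow S U x) T <-> isotropy (flow S) x T.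
Proof.
rewrite /isotropy /= -flowD; split=> [Tx|Tx].
  by rewrite -[RHS](flowK U) -Tx -flowD [T + U]addrC addKr.
by rewrite addrC flowD Tx.
Qed.

Lemma chart_smooth_continuous (c : chart R S (k + n)) x m (f : S -> 'rV[R]_m) :
  atlas S c -> chart_dom c x -> smooth (f \o chart_inv c) (c x) -> {for x, continuous f}.
Proof.
move=> cA xc /smooth_continuous sf.
have H : {for x, continuous ((f \o chart_inv c) \o c)}.
  by apply: continuous_comp => //; exact: (chart_continuous cA xc).
rewrite /prop_for /continuous_at -{2}(chart_mapK cA xc).
apply: cvg_trans H; apply: near_eq_cvg.
by apply: filterS (near_chart_dom cA xc) => y yc /=; rewrite (chart_mapK cA).
Qed.

(* The points [y] and [flow T y] have the same image under [fintegrals], hence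
   differ by the local time [s (flow T y) - s y], which corrects [T]. *)
Lemma isotropy_section (c : chart R S (k + n)) x T : atlas S c -> chart_dom c x ->
  isotropy (flow S) x T -> exists tau : S -> 'rV[R]_n,
  [/\ smooth (tau \o chart_inv c) (c x), tau x = T &
      \forall y \near x, isotropy (flow S) y (tau y)].
Proof.
move=> cA xc Tx; have [s [ss s0 [V V0 HV] _]] := local_time cA xc.
have cT : {for x, continuous (flow S T)}.
  by apply: flow_continuous2; [exact: cst_continuous|exact: cvg_id].
have cTx : flow S T y @[y --> x] --> x by rewrite -[X in _ --> X]Tx; exact: cT.
exists (fun y => T - s (flow S T y) + s y); split.
- apply: smoothD => //; apply: smoothB; first exact: smooth_cst.
  pose psi v := flow_chart c c (row_mx T v).
  have psi0 : psi (c x) = c x by rewrite /psi flow_chartE // Tx.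
  have spsi : smooth psi (c x).
    apply: (@smooth_comp _ _ _ _ (flow_chart c c) (fun v => row_mx T v)).
      by apply: smooth_row_mx; [exact: smooth_cst|exact: smooth_id].
    by apply: flow_chart_smooth => //; rewrite Tx.
  apply: (@smooth_ext _ _ _ ((s \o chart_inv c) \o psi)).
    have n1 := near_chart_inv cA xc (cTx _ (near_chart_dom cA xc)).
    apply: filterS2 n1 (near_chart_cod cA xc) => v /= Tvc vc.
    by rewrite /psi /flow_chart row_mxKl row_mxKr (chart_mapK cA).
  by apply: smooth_comp => //; rewrite psi0.
- by rewrite Tx subrK.
- apply: filterS2 V0 (cTx _ V0) => y Vy VTy; rewrite /isotropy /=.
  have FT : fintegrals y = fintegrals (flow S T y) by rewrite fintegrals_flow.
  have -> : T - s (flow S T y) + s y = - (s (flow S T y) - s y) + T.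
    by apply/rowP => i; rewrite !mxE; ring.
  by have := HV _ _ Vy VTy FT; set a := s _ - _ => E; rewrite flowD E flowK.
Qed.

(** A short period [T] of [y] would give [s y = s y + T] for the local time [s]. One radius serves
    all nearby points because [s] is defined on a neighbourhood. *)
Lemma isotropy_uniformly_discrete x : exists2 e, 0 < e & \forall y \near x,
  forall T, `|T| < e -> isotropy (flow S) y T -> T = 0.
Proof.
have [_ /(_ x)[c cA xc] _] := atlasP S.
have [s [_ _ _ [e e0 He]]] := local_time cA xc.
exists e => //; apply: filterS He => y Hy T Te Ty.
by have := Hy T Te; rewrite Ty => /eqP; rewrite -subr_eq0 opprD addNKr oppr_eq0 => /eqP.
Qed.

(* Local times bound, near each point of the compact orbit, the time needed to
   reach it from [x]. *)
Lemma isotropy_cocompact x : exists r, forall T, exists2 U, `|U| <= r &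
  isotropy (flow S) x (T - U).
Proof.
have [_ /(_ x)[c cA xc] _] := atlasP S.
have [s [ss s0 [V V0 HV] _]] := local_time cA xc.
have cs := chart_smooth_continuous cA xc ss.
have /compact_near_coveringP/near_covering_withinP orbit_cover := @flow_orbit_compact _ _ _ S x.
pose P r y := exists2 T, `|T| <= r & y = flow S T x.
have : \forall r \near +oo, orbit_of (flow S) x `<=` P r.
  apply: (orbit_cover _ (pinfty_nbhs R)) => _ [T1 _ <-].
  have nV : \forall y \near x, V y /\ `|s y| < 1.
    apply: filterI V0 _; move: cs => /cvgr_distC_lt /(_ 1 ltr01).
    by rewrite s0; apply: filterS => y; rewrite subr0.
  have cT : flow S (- T1) y @[y --> flow S T1 x] --> x.
    have cc : {for flow S T1 x, continuous (flow S (- T1))}.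
      by apply: flow_continuous2; [exact: cst_continuous|exact: cvg_id].
    by rewrite -[X in _ --> X](flowK T1); exact: cc.
  exists ([set y | V (flow S (- T1) y) /\ `|s (flow S (- T1) y)| < 1], [set r | `|T1| + 1 <= r]).
    by split=> /=; [exact: (cT _ nV)|apply: nbhs_pinfty_ge; exact: num_real].
  move=> [y r] /= [[Vy sy] rT] [T _ Ty].
  exists (T1 + s (flow S (- T1) y)).
    by apply: le_trans (ler_normD _ _) _; apply: le_trans rT; rewrite lerD2l ltW.
  have := HV _ _ (nbhs_singleton V0) Vy; rewrite fintegrals_flow -Ty fintegrals_flow => /(_ erefl).
  rewrite s0 subr0 Ty => E.
  by rewrite flowD -E -flowD addrN flow0.
move=> [r [_ Hr]]; exists (r + 1) => T.
have [||U Ur TU] := Hr (r + 1) _ (flow S T x); [by rewrite ltrDl|by exists T|].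
by exists U => //; rewrite /isotropy /= addrC flowD TU flowK.
Qed.

End Isotropy.

(** * Plane geometry and lattice bases *)

Section PlaneLattice.
Context {R : realType}.
Implicit Types (u v w : 'rV[R]_2).

Definition det2 u v : R := u 0 0 * v 0 1 - u 0 1 * v 0 0.

Lemma rV2P u v : u 0 0 = v 0 0 -> u 0 1 = v 0 1 -> u = v.
Proof.
move=> e0 e1; apply/rowP => i; have [->|->] : i = 0 \/ i = 1 => //.
by case: i => [[|[|//]] ilt]; [left|right]; exact: val_inj.
Qed.

Lemma det2Dl u v w : det2 (u + v) w = det2 u w + det2 v w.
Proof. by rewrite /det2 !mxE; ring. Qed.

Lemma det2Dr u v w : det2 w (u + v) = det2 w u + det2 w v.
Proof. by rewrite /det2 !mxE; ring. Qed.

Lemma det2Zl a u v : det2 (a *: u) v = a * det2 u v.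
Proof. by rewrite /det2 !mxE; ring. Qed.

Lemma det2Zr a u v : det2 u (a *: v) = a * det2 u v.
Proof. by rewrite /det2 !mxE; ring. Qed.

Lemma det2xx u : det2 u u = 0.
Proof. by rewrite /det2; ring. Qed.

Lemma det2C u v : det2 u v = - det2 v u.
Proof. by rewrite /det2; ring. Qed.

Lemma det2_expand u v w : det2 u v != 0 ->
  w = (det2 w v / det2 u v) *: u + (det2 u w / det2 u v) *: v.
Proof. by move=> D0; apply: rV2P; rewrite !mxE; move: D0; rewrite /det2 => D0; field. Qed.

Lemma det2_combination u v (a b c d : R) :
  det2 (a *: u + b *: v) (c *: u + d *: v) = (a * d - b * c) * det2 u v.
Proof. by rewrite /det2 !mxE; ring. Qed.

Lemma det2_independent u v (a b c d : R) : det2 u v != 0 ->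
  a *: u + b *: v = c *: u + d *: v -> a = c /\ b = d.
Proof.
move=> D0 E; split; apply: (mulIf D0).
  by have := congr1 (det2^~ v) E; rewrite !det2Dl !det2Zl det2xx !mulr0 !addr0.
by have := congr1 (det2 u) E; rewrite !det2Dr !det2Zr det2xx !mulr0 !add0r.
Qed.

Lemma det2_continuous (V : topologicalType) (f g : V -> 'rV[R]_2) x :
  {for x, continuous f} -> {for x, continuous g} ->
  {for x, continuous (fun y => det2 (f y) (g y))}.
Proof.
move=> cf cg.
have cc i (h : V -> 'rV[R]_2) : {for x, continuous h} -> {for x, continuous (fun y => h y 0 i)}.
  by move=> ch; apply: (@continuous_comp _ _ _ h (fun M : 'rV[R]_2 => M 0 i));
    [exact: ch|exact: coord_continuous].
apply: (@continuousB _ _ _ (fun y => f y 0 0 * g y 0 1) (fun y => f y 0 1 * g y 0 0)).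
  by apply: continuousM; exact: cc.
by apply: continuousM; exact: cc.
Qed.

Lemma nearest_int (a : R) : exists m : int, `|a - m%:~R| <= 1 / 2.
Proof.
exists (Num.floor (a + 1 / 2)); have := floor_itv (a + 1 / 2).
rewrite intrD ler_norml => /andP[]; lra.
Qed.

Lemma finite_has_min (D : set R) : finite_set D -> D !=set0 ->
  exists2 m, D m & forall d, D d -> m <= d.
Proof.
move=> /finite_seqP[s ->] [a /= as0].
elim: s a as0 => [//|b s IH] a _.
case: (s =P [::]) => [->|/eqP].
  by exists b => /=; [rewrite mem_head|move=> d; rewrite inE => /eqP ->].
case: s IH => [//|e s] IH _; have [m ms Hm] := IH e (mem_head _ _).
case: (leP b m) => bm.
  exists b => /=; first by rewrite mem_head.
  move=> d; rewrite inE => /predU1P[-> //|/Hm]; exact: le_trans.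
exists m => /=; first by rewrite inE; apply/orP; right.
by move=> d; rewrite inE => /predU1P[->|/Hm//]; exact: ltW.
Qed.

End PlaneLattice.

Section LatticeFinite.
Context {R : realType} {k n : nat} (S : integrable_system R k n).

(** Two periods in one ball of radius [e / 2] differ by a period shorter than [e], hence coincide;
    finitely many such balls cover the closed ball of radius [r]. *)
Lemma isotropy_bounded_finite (x : S) (r : R) :
  finite_set [set T | isotropy (flow S) x T /\ `|T| <= r].
Proof.
have [e e0 /nbhs_singleton He] := isotropy_uniformly_discrete x.
have : compact [set T : 'rV[R]_n | `|T| <= r].
  apply: bounded_closed_compact.
    exists r; split; first exact: num_real.
    by move=> M rM T /= Tr; apply: le_trans Tr (ltW rM).
  have -> : [set T : 'rV[R]_n | `|T| <= r] = (fun T => `|T|) @^-1` [set a | a <= r] by [].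
  by apply: closed_comp; [move=> T _; exact: norm_continuous|exact: closed_le].
rewrite compact_cover => /(_ 'rV[R]_n setT (fun y => ball y (e / 2))) [].
- by move=> y _; exact: ball_open.
- by move=> T _; exists T => //; apply: ballxx; rewrite divr_gt0.
move=> D _ HD.
have : finite_set (\bigcup_(y in [set` D]) (isotropy (flow S) x `&` ball y (e / 2))).
  apply: bigcup_finite => [|y _]; first exact: finite_fset.
  have [[T [Tx Ty]]|H] := pselect (exists T, (isotropy (flow S) x `&` ball y (e / 2)) T).
    apply: (@sub_finite_set _ _ [set T]); last exact: finite_set1.
    move=> U [Ux Uy] /=; apply/eqP; rewrite -subr_eq0; apply/eqP/He; last exact: isotropyB.
    have -> : U - T = (U - y) + (y - T) by rewrite addrA subrK.
    apply: le_lt_trans (ler_normD _ _) _; rewrite (splitr e) distrC.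
    by move: Ty Uy; rewrite -!ball_normE /= => Ty Uy; rewrite ltrD.
  apply: (@sub_finite_set _ _ set0); last exact: finite_set0.
  by move=> T HT; apply: H; exists T.
apply: sub_finite_set => T [Tx Tr]; have [y yD yT] := HD T Tr.
by exists y.
Qed.

End LatticeFinite.

Section LatticeBasis.
Context {R : realType} {k : nat} (S : integrable_system R k 2).

Definition lattice_basis (x : S) (T1 T2 : 'rV[R]_2) : Prop :=
  [/\ isotropy (flow S) x T1, isotropy (flow S) x T2, det2 T1 T2 != 0 &
      forall T, isotropy (flow S) x T ->
        exists a b : int, T = T1 *~ a + T2 *~ b].

(** Rounding the real coordinates of a period leaves a period with coordinates at most 1/2, which
    vanishes by assumption. Only a compact set of coordinates is tested, so the criterion propagates
    to nearby points. *)
Lemma reduce_lattice (x : S) T1 T2 :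
  isotropy (flow S) x T1 -> isotropy (flow S) x T2 -> det2 T1 T2 != 0 ->
  (forall a b : R, `|a| <= 1 / 2 -> `|b| <= 1 / 2 ->
     isotropy (flow S) x (a *: T1 + b *: T2) -> a *: T1 + b *: T2 = 0) ->
  lattice_basis x T1 T2.
Proof.
move=> T1x T2x D0 H; split=> // T Tx.
have TE := det2_expand T D0; set a := _ / _ in TE; set b := _ / det2 T1 T2 in TE.
have [ma Ha] := nearest_int a; have [mb Hb] := nearest_int b.
exists ma, mb; apply/eqP; rewrite -subr_eq0; apply/eqP.
have E : T - (T1 *~ ma + T2 *~ mb) = (a - ma%:~R) *: T1 + (b - mb%:~R) *: T2.
  by rewrite -(scaler_int ma T1) -(scaler_int mb T2) {1}TE; apply/rowP => i; rewrite !mxE; ring.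
rewrite E; apply: H => //; rewrite -E.
by apply: isotropyB => //; apply: isotropyD; exact: isotropyMz.
Qed.

Lemma isotropy_rank2 (x : S) : exists T1 T2,
  [/\ isotropy (flow S) x T1, isotropy (flow S) x T2 & det2 T1 T2 != 0].
Proof.
have [r0 H0] := isotropy_cocompact x; pose r := Num.max r0 0.
have r_ge0 : 0 <= r by rewrite le_max lexx orbT.
(* Periods within [r] of [M] times the unit vectors have diagonal entries at least [r + 1] and
   off-diagonal entries at most [r] in size, so their determinant is at least
   [(r + 1) ^ 2 - r ^ 2 > 0]. *)
pose M := 2 * r + 1.
have H T : exists2 U, `|U| <= r & isotropy (flow S) x (T - U).
  by have [U Ur TU] := H0 T; exists U => //; rewrite le_max Ur.
have [U1 U1r T1x] := H (M *: delta_mx 0 0); have [U2 U2r T2x] := H (M *: delta_mx 0 1).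
exists (M *: delta_mx 0 0 - U1), (M *: delta_mx 0 1 - U2); split=> //.
rewrite /det2 !mxE !eqxx /= !mulr1 !mulr0 !sub0r.
have B (U : 'rV[R]_2) i : `|U| <= r -> - r <= U 0 i <= r.
  by move=> Ur; rewrite -ler_norml; apply: le_trans (coord_norm_le _ _ _) Ur.
have /andP[a1 a2] := B _ 0 U1r; have /andP[b1 b2] := B _ 1 U1r.
have /andP[c1 c2] := B _ 0 U2r; have /andP[d1 d2] := B _ 1 U2r.
rewrite gt_eqF // /M subr_gt0.
apply: (@le_lt_trans _ _ (r * r)); first nra.
by apply: (@lt_le_trans _ _ ((r + 1) * (r + 1))); nra.
Qed.

(* A pair of periods of least nonzero [`|det2|] is a basis: otherwise reducing a
   period modulo the pair would at least halve the determinant. *)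
Lemma exists_lattice_basis (x : S) : exists T1 T2, lattice_basis x T1 T2.
Proof.
have [V1 [V2 [V1x V2x V0]]] := isotropy_rank2 x.
(* Combinations with coefficients at most 1/2 of vectors of norm at most [r] again have norm at most
   [r]. Restricting to such periods makes the set [D] finite, and this [r] admits [V1] and [V2]. *)
pose r := `|V1| + `|V2|.
pose A := [set T | isotropy (flow S) x T /\ `|T| <= r].
pose D := [set d | exists T1 T2, [/\ A T1, A T2, det2 T1 T2 != 0 & d = `|det2 T1 T2|]].
have finA : finite_set A by exact: isotropy_bounded_finite.
have finD : finite_set D.
  apply: (@sub_finite_set _ _ [set `|det2 T.1 T.2| | T in A `*` A]).
    by move=> d [T1 [T2 [T1A T2A _ ->]]]; exists (T1, T2).
  by apply: finite_image; exact: finite_setX.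
have V1r : `|V1| <= r by rewrite lerDl.
have V2r : `|V2| <= r by rewrite lerDr.
have D0 : D !=set0 by exists `|det2 V1 V2|, V1, V2.
have [_ [T1 [T2 [[T1x T1r] [T2x T2r] T0 ->]]] Dmin] := finite_has_min finD D0.
exists T1, T2; apply: reduce_lattice => // a b a2 b2 Tx.
set T := a *: T1 + b *: T2 in Tx *.
have AT : A T.
  split=> //; apply: le_trans (ler_normD _ _) _; rewrite !normrZ.
  have := ler_wpM2r (normr_ge0 T1) a2; have := ler_wpM2r (normr_ge0 T2) b2.
  lra.
have N0 : 0 < `|det2 T1 T2| by rewrite normr_gt0.
have aE : det2 T T2 = a * det2 T1 T2 by rewrite det2Dl !det2Zl det2xx mulr0 addr0.
have bE : det2 T1 T = b * det2 T1 T2 by rewrite det2Dr !det2Zr det2xx mulr0 add0r.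
have half c : `|c| <= 1 / 2 -> `|det2 T1 T2| <= `|c * det2 T1 T2| -> False.
  by move=> c2; rewrite normrM => c3; have := ler_wpM2r (ltW N0) c2; lra.
have a0 : a = 0.
  apply/eqP/negPn/negP => an0; apply: (half _ a2); rewrite -aE; apply: Dmin.
  by exists T, T2; split=> //; rewrite aE mulf_neq0.
have b0 : b = 0.
  apply/eqP/negPn/negP => bn0; apply: (half _ b2); rewrite -bE; apply: Dmin.
  by exists T1, T; split=> //; rewrite bE mulf_neq0.
by rewrite /T a0 b0 !scale0r addr0.
Qed.

End LatticeBasis.

Section LatticeSections.
Context {R : realType} {k : nat} (S : integrable_system R k 2).

(** Converse of the criterion in [reduce_lattice]: the coordinates are integers, and an integer of
    size at most 1/2 is zero. *)
Lemma lattice_basis_eq0 (x : S) T1 T2 (a b : R) : lattice_basis x T1 T2 ->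
  `|a| <= 1 / 2 -> `|b| <= 1 / 2 -> isotropy (flow S) x (a *: T1 + b *: T2) ->
  a *: T1 + b *: T2 = 0.
Proof.
move=> [T1x T2x D0 H] a2 b2 /H[ma [mb]].
rewrite -(scaler_int ma T1) -(scaler_int mb T2) => E.
have [aE bE] := det2_independent D0 E.
have small (m : int) : `|m%:~R : R| <= 1 / 2 -> m = 0.
  rewrite -intr_norm => H1; apply/eqP; rewrite -normr_le0 -ltzD1 add0r -(ltr_int R).
  by apply: le_lt_trans H1 _; lra.
move: a2 b2; rewrite aE bE => /small -> /small ->.
by rewrite !scale0r addr0.
Qed.

(* The two sections span the isotropy of [y] because, by compactness of the
   square of coordinates of size at most 1/2, no other period can appear in it
   near [x]. *)
Lemma lattice_basis_section (c : chart R S (k + 2)) (x : S) T1 T2 :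
  atlas S c -> chart_dom c x -> lattice_basis x T1 T2 ->
  exists tau1 tau2 : S -> 'rV[R]_2,
  [/\ smooth (tau1 \o chart_inv c) (c x) /\ tau1 x = T1,
      smooth (tau2 \o chart_inv c) (c x) /\ tau2 x = T2 &
      \forall y \near x, lattice_basis y (tau1 y) (tau2 y) /\
        0 < det2 (tau1 y) (tau2 y) * det2 T1 T2].
Proof.
move=> cA xc basis; have [T1x T2x D0 _] := basis.
have [tau1 [s1 e1 n1]] := isotropy_section cA xc T1x.
have [tau2 [s2 e2 n2]] := isotropy_section cA xc T2x.
exists tau1, tau2; split=> //.
have c1 := chart_smooth_continuous cA xc s1.
have c2 := chart_smooth_continuous cA xc s2.
have [e e0 He] := isotropy_uniformly_discrete x.
have n3 : \forall y \near x, 0 < det2 (tau1 y) (tau2 y) * det2 T1 T2.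
  have cd : {for x, continuous (fun y => det2 (tau1 y) (tau2 y) * det2 T1 T2)}.
    by apply: continuousM; [exact: det2_continuous|exact: cst_continuous].
  apply: (cvgr_gt (det2 (tau1 x) (tau2 x) * det2 T1 T2)) => //.
  by rewrite e1 e2 -expr2 exprn_even_gt0.
pose I : set R := [set a | `|a| <= 1 / 2].
have Icompact : compact I.
  have -> : I = [set` `[- (1 / 2), 1 / 2]%R].
    by apply/seteqP; split=> a; rewrite /I /= in_itv /= ler_norml.
  exact: segment_compact.
have /compact_near_coveringP cover := compact_setX Icompact Icompact.
pose W (p : R * R) y := p.1 *: tau1 y + p.2 *: tau2 y.
have cW p : {for (p, x), continuous (fun q : (R * R) * S => W q.1 q.2)}.
  have cfst : {for (p, x), continuous (fun q : (R * R) * S => q.1.1)}.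
    by apply: (@continuous_comp _ _ _ fst fst); exact: cvg_fst.
  have csnd : {for (p, x), continuous (fun q : (R * R) * S => q.1.2)}.
    by apply: (@continuous_comp _ _ _ fst snd); [exact: cvg_fst|exact: cvg_snd].
  have ct (t : S -> 'rV[R]_2) : {for x, continuous t} ->
      {for (p, x), continuous (fun q : (R * R) * S => t q.2)}.
    by move=> ct; apply: (@continuous_comp _ _ _ snd t); [exact: cvg_snd|exact: ct].
  apply: cvgD.
    by apply: cvgZ; [exact: cfst|exact: ct].
  by apply: cvgZ; [exact: csnd|exact: ct].
have n4 : \forall y \near x, I `*` I `<=` [set p | isotropy (flow S) y (W p y) -> W p y = 0].
  apply: cover => -[a b] [/= Ia Ib].
  suff : \forall q \near ((a, b), x), isotropy (flow S) q.2 (W q.1 q.2) -> W q.1 q.2 = 0 by [].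
  have Wx : W (a, b) x = a *: T1 + b *: T2 by rewrite /W /= e1 e2.
  (* If the combination is a period of [x], it is zero, so nearby combinations are shorter than [e]
     and uniform discreteness applies. Otherwise it moves [x], and Hausdorff separation shows that
     nearby combinations move nearby points. *)
  have [Wiso|Wniso] := pselect (isotropy (flow S) x (W (a, b) x)).
    have W0 : W (a, b) x = 0.
      by rewrite Wx; apply: (lattice_basis_eq0 basis) => //; rewrite -Wx.
    have m1 : \forall q \near ((a, b), x), `|W q.1 q.2| < e.
      move: (cW (a, b)) => /cvgr_distC_lt /(_ e e0); rewrite /= W0.
      by apply: filterS => q; rewrite subr0.
    have m2 : \forall q \near ((a, b), x), forall T, `|T| < e -> isotropy (flow S) q.2 T -> T = 0.
      exact: (@cvg_snd _ _ (nbhs (a, b)) (nbhs x) _ _ He).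
    by apply: filterS2 m1 m2 => q qe; apply.
  have sep : flow S (W (a, b) x) x != x by apply/eqP.
  move: (@manifold_hausdorff _ _ S); rewrite open_hausdorff => /(_ _ _ sep).
  move=> [[A B] /= [/set_mem Ax /set_mem Bx] [oA oB AB0]].
  have cf : {for ((a, b), x), continuous (fun q : (R * R) * S => flow S (W q.1 q.2) q.2)}.
    by apply: flow_continuous2; [exact: cW|exact: cvg_snd].
  have m1 : \forall q \near ((a, b), x), A (flow S (W q.1 q.2) q.2).
    by apply: cf; exact: open_nbhs_nbhs.
  have m2 : \forall q \near ((a, b), x), B q.2.
    by apply: (@cvg_snd _ _ (nbhs (a, b)) (nbhs x)); exact: open_nbhs_nbhs.
  apply: filterS2 m1 m2 => q qA qB; rewrite /isotropy /= => qE; exfalso.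
  rewrite qE in qA.
  by have : (A `&` B) q.2 by []; rewrite (eqP AB0).
have n12 : \forall y \near x, isotropy (flow S) y (tau1 y) /\ isotropy (flow S) y (tau2 y).
  by apply: filterS2 n1 n2.
apply: filterS3 n12 n3 n4 => y [y1 y2] y3 y4; split=> //.
apply: reduce_lattice => //.
  by apply: contraTneq y3 => ->; rewrite mul0r ltxx.
by move=> a b a2 b2; exact: (y4 (a, b)).
Qed.

End LatticeSections.

(** * The map rho *)

Section QuotientZmodule.
Local Open Scope quotient_scope.

Lemma pi_quot_eq0 (V : zmodType) (I : zmodClosed V) (x : V) :
  \pi_(Quotient.quot I) x = 0 <-> x \in I.
Proof.
have pi0 : \pi_(Quotient.quot I) 0 = 0 by exact: raddf0.
rewrite -pi0; split=> [/eqP|xI]; first by rewrite -Quotient.idealrBE subr0.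
by apply/eqP; rewrite -Quotient.idealrBE subr0.
Qed.

(** If [p] annihilates [m] times a representative, then [m * p] annihilates the representative,
    which is therefore torsion. *)
Lemma mod_torsion_mulz_eq0 (V : zmodType) (x : mod_torsion V) (m : int) :
  x *~ m = 0 -> m != 0 -> x = 0.
Proof.
wlog: m / 0 <= m => [H xm m0|].
  case: (leP 0 m) => [m_ge0|/ltW m_le0]; first exact: (H m).
  by apply: (H (- m)); rewrite ?oppr_ge0 ?oppr_eq0 // mulrNz xm oppr0.
case: m => // m _; rewrite -[x]reprK -pmulrn => xm m0.
have m_gt0 : (0 < m)%N by rewrite lt0n.
apply/pi_quot_eq0; rewrite inE; apply/asboolP.
have /pi_quot_eq0 : \pi_(mod_torsion V) (repr x *+ m) = 0 by rewrite raddfMn.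
rewrite inE => /asboolP[p p0 xp].
by exists (m * p)%N; rewrite ?muln_gt0 ?m_gt0 // mulrnA.
Qed.

End QuotientZmodule.

Section Cycles.
Context {R : realType} (M : topologicalType).
Local Open Scope quotient_scope.

Lemma cycle1_classD (z w : cycle1 R M) : cycle1_class (z + w) = cycle1_class z + cycle1_class w.
Proof. by rewrite /cycle1_class !raddfD. Qed.

Lemma cycle1_valD (z w : cycle1 R M) : cycle1_val (z + w) = cycle1_val z + cycle1_val w.
Proof. exact: (raddfD (val : cycle1 R M -> {freeg (sing R M 1) / int})). Qed.

Lemma cycle1_class_boundary (z w : cycle1 R M) (c : {freeg (sing R M 2) / int}) :
  boundary c = cycle1_val z - cycle1_val w -> cycle1_class z = cycle1_class w.
Proof.
move=> E; congr (\pi _); apply/eqP; rewrite -Quotient.idealrBE inE.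
by apply/asboolP; exists c.
Qed.

Definition sing_of q (f : simplex R q -> M) (fc : continuous f) : sing R M q := mkcts fc.

Lemma boundary2 (s : sing R M 2) :
  boundary << s >> = << sing_face ord0 s >> - << sing_face (inord 1) s >> + << sing_face ord_max s >>.
Proof.
rewrite /boundary liftU scale1r !big_ord_recl big_ord0 /= addr0 expr0 expr1 scale1r scaleN1r.
rewrite /bump /= expr2 mulrNN mulr1 scale1r addrA; congr (_ - << sing_face _ _ >> + << sing_face _ _ >>).
  by apply: val_inj; rewrite /= inordK.
by apply: val_inj.
Qed.

Lemma coord_face q (i : 'I_q.+2) (p : simplex R q) (j : 'I_q.+1) :
  val (face i p) 0 (fintype.lift i j) = val p 0 j.
Proof. by rewrite mxE liftK. Qed.

Lemma coord_face0 q (i : 'I_q.+2) (p : simplex R q) : val (face i p) 0 i = 0.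
Proof. by rewrite mxE unlift_none. Qed.

Lemma simplex1E (p : simplex R 1) : val p 0 0 = 1 - val p 0 1.
Proof.
have [_] := set_mem (valP p); rewrite !big_ord_recl big_ord0 addr0 => <-.
have -> : fintype.lift ord0 ord0 = 1 :> 'I_2 by exact: val_inj.
by rewrite addrK.
Qed.

Lemma simplex_coord_itv q (p : simplex R q) i : 0 <= val p 0 i <= 1.
Proof.
have [p0 p1] := set_mem (valP p); rewrite p0 /= -p1 (bigD1 i) //= lerDl.
by apply: sumr_ge0 => j _; exact: p0.
Qed.

Lemma simplex_coord_continuous q (i : 'I_q.+1) : continuous (fun p : simplex R q => val p 0 i).
Proof.
move=> p; apply: (@continuous_comp _ _ _ set_val (fun v : 'rV[R]_q.+1 => v 0 i)).
  exact: initial_continuous.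
exact: coord_continuous.
Qed.

End Cycles.

Section Rho.
Context {R : realType} {k n : nat} (S : integrable_system R k n).

(** [rho] at a point instead of an orbit, with value 0 off the isotropy so that no proof of
    periodicity is carried along. *)
Definition rho_at (x : S) (T : 'rV[R]_n) : homology1_mod_torsion R S :=
  if pselect (isotropy (flow S) x T) is left Tx then loop_class Tx else 0.

Lemma rho_atE x T (Tx : isotropy (flow S) x T) : rho_at x T = loop_class Tx.
Proof.
by rewrite /rho_at; case: pselect => // Tx'; congr loop_class; exact: Prop_irrelevance.
Qed.

Let i2 : 'I_3 := ord_max.

Lemma face2_coord0 (p : simplex R 1) :
  val (face ord0 p) 0 1 = 1 - val p 0 1 /\ val (face ord0 p) 0 i2 = val p 0 1.
Proof.
split.
  have -> : (1 : 'I_3) = fintype.lift ord0 0 by exact: val_inj.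
  by rewrite coord_face simplex1E.
have -> : i2 = fintype.lift ord0 1 by exact: val_inj.
by rewrite coord_face.
Qed.

Lemma face2_coord1 (p : simplex R 1) :
  val (face (inord 1) p) 0 1 = 0 /\ val (face (inord 1) p) 0 i2 = val p 0 1.
Proof.
split.
  have -> : (1 : 'I_3) = inord 1 by apply: val_inj; rewrite /= inordK.
  exact: coord_face0.
have -> : i2 = fintype.lift (inord 1) 1 by apply: val_inj; rewrite /= /bump inordK.
by rewrite coord_face.
Qed.

Lemma face2_coord2 (p : simplex R 1) :
  val (face i2 p) 0 1 = val p 0 1 /\ val (face i2 p) 0 i2 = 0.
Proof.
split; last exact: coord_face0.
have -> : (1 : 'I_3) = fintype.lift i2 1 by exact: val_inj.
by rewrite coord_face.
Qed.

Lemma rho_atD x T U : isotropy (flow S) x T -> isotropy (flow S) x U ->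
  rho_at x (T + U) = rho_at x T + rho_at x U.
Proof.
move=> Tx Ux; have TUx := isotropyD Tx Ux.
rewrite (rho_atE TUx) (rho_atE Tx) (rho_atE Ux) -cycle1_classD; apply/esym.
(* The triangle with vertices at times 0, [T] and [T + U]: two edges are the loops of [T] and
   [T + U], the third is that of [U] shifted by the period [T]. *)
pose f (p : simplex R 2) := flow S (val p 0 1 *: T + val p 0 i2 *: (T + U)) x.
have fc : continuous f.
  move=> p; refine (@flow_continuous2 _ _ _ S (simplex R 2 : topologicalType)
    (fun p : simplex R 2 => val p 0 1 *: T + val p 0 i2 *: (T + U)) (fun=> x) p _ _); last exact: cst_continuous.
  have cZ i W : continuous (fun p : simplex R 2 => val p 0 i *: W : 'rV[R]_n).
    move=> q; apply: (@continuous_comp _ _ _ (fun p : simplex R 2 => val p 0 i) (fun a => a *: W)).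
      exact: simplex_coord_continuous.
    exact: scalel_continuous.
  apply: (@continuousD _ _ _ (fun p : simplex R 2 => val p 0 1 *: T)
    (fun p : simplex R 2 => val p 0 i2 *: (T + U))); exact: cZ.
apply: (@cycle1_class_boundary _ _ _ _ << sing_of fc >>).
rewrite boundary2 cycle1_valD /=.
have -> : sing_face ord0 (sing_of fc) = loop_simplex U x.
  apply/continuousEP => p; rewrite /sing_face /= /mkcts /f /loop /=.
  have [-> ->] := face2_coord0 p.
  have -> : (1 - val p 0 1) *: T + val p 0 1 *: (T + U) = val p 0 1 *: U + T.
    by apply/rowP => j; rewrite !mxE; ring.
  by rewrite flowD Tx.
have -> : sing_face (inord 1) (sing_of fc) = loop_simplex (T + U) x.
  apply/continuousEP => p; rewrite /sing_face /= /mkcts /f /loop /=.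
  by have [-> ->] := face2_coord1 p; rewrite scale0r add0r.
have -> : sing_face i2 (sing_of fc) = loop_simplex T x.
  apply/continuousEP => p; rewrite /sing_face /= /mkcts /f /loop /=.
  by have [-> ->] := face2_coord2 p; rewrite scale0r addr0.
by rewrite addrAC [X in X - _]addrC.
Qed.

(* The square [(s, t) |-> flow (t *: T s) (p s)] is cut along its diagonal; its
   sides [t = 0] and [t = 1] coincide. *)
Lemma rho_at_homotopy (p : R -> S) (T : R -> 'rV[R]_n) :
  (forall s, 0 <= s <= 1 -> [/\ {for s, continuous p}, {for s, continuous T} &
     isotropy (flow S) (p s) (T s)]) ->
  rho_at (p 0) (T 0) = rho_at (p 1) (T 1).
Proof.
move=> H.
have i0 : 0 <= (0 : R) <= 1 by rewrite lexx ler01.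
have i1 : 0 <= (1 : R) <= 1 by rewrite lexx ler01.
have [_ _ H0] := H _ i0; have [_ _ H1] := H _ i1.
rewrite (rho_atE H0) (rho_atE H1); apply/esym.
pose f (s t : simplex R 2 -> R) (u : simplex R 2) := flow S (t u *: T (s u)) (p (s u)).
have fc (s t : simplex R 2 -> R) : continuous s -> continuous t -> (forall u, 0 <= s u <= 1) -> continuous (f s t).
  move=> cs ct s01 u; have [cp cT _] := H _ (s01 u).
  refine (@flow_continuous2 _ _ _ S (simplex R 2 : topologicalType)
    (fun u : simplex R 2 => t u *: T (s u)) (fun u => p (s u)) u _ _).
    have cTs : {for u, continuous (T \o s)} by apply: continuous_comp; [exact: cs|exact: cT].
    exact: (@cvgZ _ _ _ _ (nbhs_filter u) t (T \o s) _ _ (ct u) cTs).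
  by apply: (@continuous_comp _ _ _ s p); [exact: cs|exact: cp].
(* Since [x2 <= x12], the pair [(s, t) = (x12, x2)] parametrizes the half [t <= s] of the square,
   and the exchanged pair the half [s <= t]. *)
pose x12 (u : simplex R 2) := val u 0 1 + val u 0 i2.
pose x2 (u : simplex R 2) := val u 0 i2.
have cx2 : continuous x2 by exact: simplex_coord_continuous.
have cx12 : continuous x12.
  move=> u; apply: (@continuousD _ _ _ (fun u : simplex R 2 => val u 0 1 : R)
    (fun u : simplex R 2 => val u 0 i2 : R)); exact: simplex_coord_continuous.
have x2_itv u : 0 <= x2 u <= 1 by exact: simplex_coord_itv.
have x12_itv u : 0 <= x12 u <= 1.
  have [u0] := set_mem (valP u); rewrite !big_ord_recl big_ord0 addr0 => u1.
  have := u0 0; have := u0 1; have := u0 i2; rewrite /x12.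
  have e1 : fintype.lift ord0 ord0 = 1 :> 'I_3 by exact: val_inj.
  have e2 : fintype.lift ord0 (fintype.lift ord0 ord0) = i2 by exact: val_inj.
  move: u1; rewrite e1 e2 -[ord0]/(0 : 'I_3); lra.
pose s1 := sing_of (fc _ _ cx12 cx2 x12_itv).
pose s2 := sing_of (fc _ _ cx2 cx12 x2_itv).
apply: (@cycle1_class_boundary _ _ _ _ (<< s1 >> - << s2 >>)).
rewrite boundaryB !boundary2 /=.
have -> : sing_face ord0 s1 = loop_simplex (T 1) (p 1).
  apply/continuousEP => q; rewrite /sing_face /= /mkcts /f /x12 /x2 /loop /=.
  by have [-> ->] := face2_coord0 q; rewrite subrK.
have -> : sing_face i2 s2 = loop_simplex (T 0) (p 0).
  apply/continuousEP => q; rewrite /sing_face /= /mkcts /f /x12 /x2 /loop /=.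
  by have [-> ->] := face2_coord2 q; rewrite addr0.
have -> : sing_face (inord 1) s1 = sing_face (inord 1) s2.
  apply/continuousEP => q; rewrite /sing_face /= /mkcts /f /x12 /x2 /=.
  by have [-> ->] := face2_coord1 q; rewrite add0r.
have -> : sing_face i2 s1 = sing_face ord0 s2.
  apply/continuousEP => q; rewrite /sing_face /= /mkcts /f /x12 /x2 /=.
  have [-> ->] := face2_coord2 q; have [-> ->] := face2_coord0 q.
  rewrite addr0 scale0r flow0 subrK scale1r.
  by have [_ _ ->] := H _ (simplex_coord_itv q 1).
set a := << _ >>; set b := << _ >>; set d := << _ >>; set e := << _ >>.
have E4 (V : zmodType) (a' b' d' e' : V) : a' - b' + d' - (d' - b' + e') = a' - e'.
  by rewrite -(addrA a') [- b' + _]addrC opprD addrA addrK.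
exact: E4.
Qed.

End Rho.

(** * The global period *)

(** The rows [(p, q)] and [(- v, u)] form a matrix of determinant 1, whose integer inverse recovers
    [al] and [be]. *)
Lemma unimodular_eq0 (V : zmodType) (al be : V) (p q u v : int) :
  u * p + v * q = 1 -> al *~ p + be *~ q = 0 -> al *~ - v + be *~ u = 0 ->
  al = 0 /\ be = 0.
Proof.
move=> uv E1 E2.
have al0 : (al *~ p + be *~ q) *~ u - (al *~ - v + be *~ u) *~ q = al.
  rewrite !mulrzDl -!mulrzA opprD addrACA -!mulrNz -!mulrzDr.
  have -> : p * u + - (- v * q) = 1 by rewrite -uv; ring.
  have -> : q * u + - (u * q) = 0 by ring.
  by rewrite mulr0z mulr1z addr0.
have be0 : (al *~ p + be *~ q) *~ v + (al *~ - v + be *~ u) *~ p = be.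
  rewrite !mulrzDl -!mulrzA addrACA -!mulrzDr.
  have -> : p * v + - v * p = 0 by ring.
  have -> : q * v + u * p = 1 by rewrite -uv; ring.
  by rewrite mulr0z mulr1z add0r.
by split; [rewrite -[LHS]al0 E1 E2 !mul0rz subrr|rewrite -[LHS]be0 E1 E2 !mul0rz addr0].
Qed.

Section PeriodSection.
Context {R : realType} {k : nat} (S : integrable_system R k 2).
Implicit Types (x y : S) (T : 'rV[R]_2).

Lemma rho_at0 x : rho_at x 0 = 0.
Proof.
apply: (addIr (rho_at x 0)).
by rewrite -rho_atD ?addr0 ?add0r //; exact: isotropy0.
Qed.

Lemma rho_atMz x T (a : int) : isotropy (flow S) x T -> rho_at x (T *~ a) = rho_at x T *~ a.
Proof.
move=> Tx; have H (m : nat) : rho_at x (T *~ m%:Z) = rho_at x T *~ m%:Z.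
  elim: m => [|m IH]; first by rewrite !mulr0z rho_at0.
  rewrite intS !mulrzDr rho_atD ?mulr1z ?IH //; exact: isotropyMz.
case: a => m; first exact: H.
apply: (addIr (rho_at x (T *~ m.+1%:Z))).
rewrite -rho_atD; [|exact: isotropyMz..].
by rewrite NegzE -mulrzDr addNr mulr0z rho_at0 H -mulrzDr addNr mulr0z.
Qed.

Lemma rho_at_combination x T1 T2 (a b : int) :
  isotropy (flow S) x T1 -> isotropy (flow S) x T2 ->
  rho_at x (T1 *~ a + T2 *~ b) = rho_at x T1 *~ a + rho_at x T2 *~ b.
Proof. by move=> T1x T2x; rewrite rho_atD ?rho_atMz //; exact: isotropyMz. Qed.

Lemma rho_at_flow x T U : isotropy (flow S) x T -> rho_at (flow S U x) T = rho_at x T.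
Proof.
move=> Tx; pose p (s : R) := flow S (s *: U) x.
have p0 : p 0 = x by rewrite /p scale0r flow0.
have p1 : p 1 = flow S U x by rewrite /p scale1r.
rewrite -{2}p0 -p1; apply/esym/(@rho_at_homotopy _ _ _ S p (fun=> T)) => s _; split.
- by apply: flow_continuous2; [exact: scalel_continuous|exact: cst_continuous].
- exact: cst_continuous.
- exact/isotropy_flow.
Qed.

(** The segment from [c x] to [c y] stays in a ball on which [tau] is smooth with periods as values,
    so the loops along it form a homotopy. *)
Lemma rho_at_section (c : chart R S (k + 2)) x (tau : S -> 'rV[R]_2) :
  atlas S c -> chart_dom c x -> smooth (tau \o chart_inv c) (c x) ->
  (\forall y \near x, isotropy (flow S) y (tau y)) ->
  \forall y \near x, rho_at y (tau y) = rho_at x (tau x).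
Proof.
move=> cA xc /smooth_near s1 /(near_chart_inv cA xc) s2.
have /near_ball_norm[d d0 Hd] : \forall v \near c x, [/\ smooth (tau \o chart_inv c) v,
    chart_cod c v & isotropy (flow S) (chart_inv c v) (tau (chart_inv c v))].
  by apply: filterS3 s1 (near_chart_cod cA xc) s2.
apply: filterS2 (near_chart_dom cA xc) (near_chart cA xc (near_norm_lt (c x) d0)) => y yc yd.
pose l (s : R) := s *: (c y - c x) + c x.
have lc : continuous l.
  by move=> s; apply: cvgD; [exact: scalel_continuous|exact: cst_continuous].
have l0 : chart_inv c (l 0) = x by rewrite /l scale0r add0r (chart_mapK cA).
have l1 : chart_inv c (l 1) = y by rewrite /l scale1r subrK (chart_mapK cA).
have homot := @rho_at_homotopy _ _ _ S (chart_inv c \o l) (tau \o chart_inv c \o l).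
rewrite -l0 -l1; apply/esym/homot => s /andP[s0 s1'].
have ls : `|l s - c x| < d.
  rewrite /l addrK normrZ ger0_norm //; apply: le_lt_trans yd.
  by apply: ler_piMl.
have [sm vc iso] := Hd (l s) ls.
split.
- apply: continuous_comp; first exact: lc.
  exact: (chart_inv_continuous_at cA vc).
- apply: continuous_comp; first exact: lc.
  exact: smooth_continuous.
- exact: iso.
Qed.

Lemma det2_intcomb (T1 T2 : 'rV[R]_2) (a b c d : int) :
  det2 (T1 *~ a + T2 *~ b) (T1 *~ c + T2 *~ d) = (a * d - b * c)%:~R * det2 T1 T2.
Proof.
by rewrite -(scaler_int a) -(scaler_int b) -(scaler_int c) -(scaler_int d)
  det2_combination rmorphB !rmorphM.
Qed.

Lemma lattice_basis_change x T1 T2 (a b c d : int) : lattice_basis x T1 T2 ->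
  (a * d - b * c) ^+ 2 = 1 -> lattice_basis x (T1 *~ a + T2 *~ b) (T1 *~ c + T2 *~ d).
Proof.
move=> [T1x T2x D0 H] e1; split.
- by apply: isotropyD; exact: isotropyMz.
- by apply: isotropyD; exact: isotropyMz.
- rewrite det2_intcomb mulf_neq0 // intr_eq0.
  by apply: contra_eq_neq e1 => ->; rewrite expr0n.
- move=> T /H[m [q ->]]; set e := a * d - b * c in e1.
  (* The inverse of an integer matrix of determinant [e] with [e ^+ 2 = 1] is [e] times its
     adjugate. *)
  exists (e * (m * d - q * c)), (e * (q * a - m * b)).
  rewrite !mulrzDl -!mulrzA addrACA -!mulrzDr.
  congr (_ *~ _ + _ *~ _).
    by rewrite -[LHS]mulr1 -e1 expr2 {2}/e; ring.
  by rewrite -[LHS]mulr1 -e1 expr2 {2}/e; ring.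
Qed.

(** Changing basis and back multiplies [det2 T1 T2] by two integer determinants, whose product is
    therefore 1. *)
Lemma lattice_basis_change_det x T1 T2 (a b c d : int) : lattice_basis x T1 T2 ->
  lattice_basis x (T1 *~ a + T2 *~ b) (T1 *~ c + T2 *~ d) -> (a * d - b * c) ^+ 2 = 1.
Proof.
move=> [T1x T2x D0 H] [T1x' T2x' D0' H'].
have [a' [b' E1]] := H' _ T1x; have [c' [d' E2]] := H' _ T2x.
have := det2_intcomb (T1 *~ a + T2 *~ b) (T1 *~ c + T2 *~ d) a' b' c' d'.
rewrite -E1 -E2 det2_intcomb mulrA -intrM => E.
have : (a' * d' - b' * c') * (a * d - b * c) = 1.
  apply/eqP; rewrite -(eqr_int R); apply/eqP/(mulIf D0).
  by rewrite mul1r -E.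
move: (a' * d' - b' * c') (a * d - b * c) => m q mq.
have : (`|m| * `|q| = 1)%N by rewrite -abszM mq.
by move/eqP; rewrite muln_eq1 => /andP[_ /eqP q1]; rewrite -real_normK ?num_real // -abszE q1 expr1n.
Qed.

Lemma lattice_basis_swap x T1 T2 : lattice_basis x T1 T2 -> lattice_basis x T2 T1.
Proof.
move=> [T1x T2x D0 H]; split=> //; first by rewrite det2C oppr_eq0.
by move=> T /H[a [b ->]]; exists b, a; rewrite addrC.
Qed.

Definition framed (al be : homology1_mod_torsion R S) x T1 T2 : Prop :=
  [/\ lattice_basis x T1 T2, 0 < det2 T1 T2, rho_at x T1 = al & rho_at x T2 = be].

(* Either condition makes [T1] the same for all oriented bases [T1], [T2] with
   classes [al], [be], although [T2] need not be. *)
Definition rigid (al be : homology1_mod_torsion R S) : Prop :=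
  (forall a b : int, al *~ a + be *~ b = 0 -> a = 0 /\ b = 0) \/
  (al = 0 /\ be != 0).

Lemma framed_unique al be x T1 T2 T1' T2' : rigid al be ->
  framed al be x T1 T2 -> framed al be x T1' T2' -> T1 = T1'.
Proof.
move=> rig [B D r1 r2] [B' D' r1' r2']; have [T1x T2x D0 H] := B.
have [T1x' T2x' _ _] := B'.
have [a [b E1]] := H _ T1x'; have [c [d E2]] := H _ T2x'.
have e1 : (a * d - b * c) ^+ 2 = 1.
  by apply: (lattice_basis_change_det B); rewrite -E1 -E2.
have e0 : 0 < a * d - b * c.
  move: D'; rewrite E1 E2 det2_intcomb pmulr_lgt0 // ltr0z //.
have {e1} e1 : a * d - b * c = 1.
  by move/eqP: e1; rewrite sqrf_eq1 => /orP[/eqP //|/eqP e]; move: e0; rewrite e.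
have ra : al = al *~ a + be *~ b by rewrite -{1}r1' E1 rho_at_combination // r1 r2.
have rb : be = al *~ c + be *~ d by rewrite -{1}r2' E2 rho_at_combination // r1 r2.
rewrite E1; suff [-> ->] : a = 1 /\ b = 0 by rewrite mulr1z mulr0z addr0.
case: rig => [ind|[al0 be0]].
  have [/eqP a1 b0] : a - 1 = 0 /\ b = 0.
    by apply: ind; rewrite mulrzBr mulr1z addrAC -ra subrr.
  by split=> //; apply/eqP; rewrite -subr_eq0.
(* Here [be *~ b = 0] and [be *~ (d - 1) = 0] with [be] nonzero in a torsion free group, so [b = 0]
   and [d = 1]; determinant 1 then gives [a = 1], while [c] stays free. *)
have b0 : b = 0.
  apply/eqP/negPn/negP => bn0; move: be0; apply/negP; rewrite negbK; apply/eqP.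
  by apply: (mod_torsion_mulz_eq0 _ bn0); move: ra; rewrite al0 mul0rz add0r => <-.
have d1 : d = 1.
  apply/eqP; rewrite -subr_eq0; apply/negPn/negP => dn0; move: be0; apply/negP; rewrite negbK; apply/eqP.
  by apply: (mod_torsion_mulz_eq0 _ dn0); rewrite mulrzBr mulr1z {2}rb al0 mul0rz add0r subrr.
by move: e1; rewrite d1 b0 mulr1 mul0r subr0.
Qed.

Lemma framed_flow al be x T1 T2 U : framed al be x T1 T2 -> framed al be (flow S U x) T1 T2.
Proof.
move=> [[T1x T2x D0 H] D r1 r2]; split; rewrite ?rho_at_flow //.
by split=> //; try exact/isotropy_flow; move=> T /isotropy_flow/H.
Qed.

Lemma framed_section al be (c : chart R S (k + 2)) x T1 T2 :
  atlas S c -> chart_dom c x -> framed al be x T1 T2 ->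
  exists tau, [/\ smooth (tau \o chart_inv c) (c x), tau x = T1 &
    \forall y \near x, exists T2', framed al be y (tau y) T2'].
Proof.
move=> cA xc [B D r1 r2].
have [tau1 [tau2 [[s1 e1] [s2 e2] nB]]] := lattice_basis_section cA xc B.
exists tau1; split=> //.
have i1 : \forall y \near x, isotropy (flow S) y (tau1 y) by apply: filterS nB => y [[]].
have i2 : \forall y \near x, isotropy (flow S) y (tau2 y) by apply: filterS nB => y [[]].
apply: filterS3 nB (rho_at_section cA xc s1 i1) (rho_at_section cA xc s2 i2) => y [yB yD] R1 R2.
exists (tau2 y); split=> //; first by move: yD; rewrite pmulr_lgt0.
  by rewrite R1 e1.
by rewrite R2 e2.
Qed.

(** The closedness half of the connectedness argument. A frame at [y] has integer coefficients in
    sections that extend a basis of [x]; the same coefficients at [x] give a frame with the same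
    classes and orientation. *)
Lemma framed_near al be x : \forall y \near x,
  (exists T1 T2, framed al be y T1 T2) -> exists T1 T2, framed al be x T1 T2.
Proof.
have [_ /(_ x)[c cA xc] _] := atlasP S.
have [S1 [S2 B]] := exists_lattice_basis x.
have [s1 [s2 [[sm1 e1] [sm2 e2] nB]]] := lattice_basis_section cA xc B.
have i1 : \forall y \near x, isotropy (flow S) y (s1 y) by apply: filterS nB => y [[]].
have i2 : \forall y \near x, isotropy (flow S) y (s2 y) by apply: filterS nB => y [[]].
apply: filterS3 nB (rho_at_section cA xc sm1 i1) (rho_at_section cA xc sm2 i2) => y [yB yD] R1 R2.
move=> [T1 [T2 [B' D r1 r2]]].
have [s1x s2x D0 H] := yB; have [T1x T2x _ _] := B'.
have [S1x S2x _ _] := B.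
have [a [b E1]] := H _ T1x; have [e [d E2]] := H _ T2x.
have u1 : (a * d - b * e) ^+ 2 = 1.
  by apply: (lattice_basis_change_det yB); rewrite -E1 -E2.
exists (S1 *~ a + S2 *~ b), (S1 *~ e + S2 *~ d); split.
- exact: lattice_basis_change.
(* Multiplying by the positive [det2 T1 T2] turns the factor [a * d - b * e], of unknown sign, into
   its square. *)
- rewrite det2_intcomb -(pmulr_lgt0 _ (_ : 0 < det2 T1 T2)) //.
  have -> : (a * d - b * e)%:~R * det2 S1 S2 * det2 T1 T2 =
    (a * d - b * e)%:~R ^+ 2 * (det2 (s1 y) (s2 y) * det2 S1 S2).
    by rewrite E1 E2 det2_intcomb; ring.
  by rewrite -rmorphXn u1 mul1r.
- by rewrite -r1 E1 !rho_at_combination // R1 R2 e1 e2.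
- by rewrite -r2 E2 !rho_at_combination // R1 R2 e1 e2.
Qed.

Lemma exists_framed x T : isotropy (flow S) x T -> rho_at x T != 0 ->
  exists al be T1 T2, rigid al be /\ framed al be x T1 T2.
Proof.
move=> Tx rT.
have [T1 [T2 [B D]]] : exists T1 T2, lattice_basis x T1 T2 /\ 0 < det2 T1 T2.
  have [T1 [T2 B]] := exists_lattice_basis x; have [_ _ D0 _] := B.
  case: (ltP 0 (det2 T1 T2)) => D; first by exists T1, T2.
  exists T2, T1; split; first exact: lattice_basis_swap.
  by rewrite det2C oppr_gt0 lt_neqAle D0.
have [T1x T2x D0 H] := B.
pose al := rho_at x T1; pose be := rho_at x T2.
have [ind|] := pselect (forall a b : int, al *~ a + be *~ b = 0 -> a = 0 /\ b = 0).
  by exists al, be, T1, T2; split; [left|].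
move=> /existsNP[a /existsNP[b /not_implyP[ab0 nab]]].
have g0 : gcdz a b != 0.
  by rewrite gcdz_eq0; apply/negP => /andP[/eqP ? /eqP ?]; apply: nab.
(* The relation may be divided by the gcd because the target is torsion free. The coprime [p], [q]
   are completed by Bezout coefficients to a unimodular matrix, and [T1'] has class 0. *)
have [p aE] := dvdzP (dvdz_gcdl a b); have [q bE] := dvdzP (dvdz_gcdr a b).
have pq0 : al *~ p + be *~ q = 0.
  by apply: (mod_torsion_mulz_eq0 _ g0); rewrite mulrzDl -!mulrzA -aE -bE.
have [u [v uv]] : exists u v, u * p + v * q = 1.
  have [u [v uvE]] := Bezoutz a b; exists u, v; apply: (mulIf g0).
  by rewrite mulrDl -!mulrA -aE -bE mul1r uvE.
have det1 : p * u - q * - v = 1 by rewrite -uv; ring.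
pose T1' := T1 *~ p + T2 *~ q; pose T2' := T1 *~ - v + T2 *~ u.
exists 0, (rho_at x T2'), T1', T2'; split.
  right; split; first reflexivity.
  (* If the class of [T2'] vanished too, [rho_at x] would vanish on the whole lattice, against the
     choice of [T]. *)
  apply/negP => /eqP r0; move/negP: rT; apply; apply/eqP.
  have r0' : al *~ - v + be *~ u = 0 by rewrite -[RHS]r0 /T2' rho_at_combination.
  have [al0 be0] := unimodular_eq0 uv pq0 r0'.
  have [m [q' ->]] := H _ Tx.
  by rewrite rho_at_combination // -/al -/be al0 be0 !mul0rz addr0.
split=> //.
- by apply: lattice_basis_change => //; rewrite det1 expr1n.
- by rewrite det2_intcomb det1 mul1r.
- by rewrite rho_at_combination.
Qed.

Lemma period_section : connected [set: S] ->
  (exists x T, isotropy (flow S) x T /\ rho_at x T != 0) ->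
  exists P : S -> 'rV[R]_2,
  [/\ forall x, isotropy (flow S) x (P x),
      forall x (a : R), isotropy (flow S) x (a *: P x) -> exists m : int, a = m%:~R,
      forall U x, P (flow S U x) = P x &
      forall c x, atlas S c -> chart_dom c x -> smooth (P \o chart_inv c) (c x)].
Proof.
move=> conn [x0 [T0 [T0x rT0]]].
have [al [be [V1 [V2 [rig F0]]]]] := exists_framed T0x rT0.
pose W := [set x | exists T1 T2, framed al be x T1 T2].
have near_fwd x : W x -> \forall y \near x, W y.
  move=> [T1 [T2 F]]; have [_ /(_ x)[c cA xc] _] := atlasP S.
  have [tau [_ _ n]] := framed_section cA xc F.
  by apply: filterS n => y [T2' F']; exists (tau y), T2'.
have WT : W = setT.
  apply: conn.
  - by exists x0, V1, V2.
  - exists W; last by rewrite setTI.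
    by rewrite openE => x /near_fwd.
  - exists W; last by rewrite setTI.
    rewrite -[W]setCK; apply: open_closedC; rewrite openE => x Wx.
    by apply: filterS (framed_near al be x) => y Hy Wy; apply: Wx; exact: Hy.
(* A choice without any continuity; by [framed_unique] it is constant on orbits and agrees near each
   point with a smooth section. *)
have /choice[P HP] : forall x, exists T1, exists T2, framed al be x T1 T2.
  by move=> x; have : W x by rewrite WT.
exists P; split.
- by move=> x; have [T2 [[]]] := HP x.
- move=> x a Ha; have [T2 [[Px T2x D0 H] _ _ _]] := HP x.
  have [m [q]] := H _ Ha; rewrite -(scaler_int m) -(scaler_int q) => E.
  exists m; apply: (proj1 (@det2_independent _ (P x) T2 a 0 m%:~R q%:~R D0 _)).
  by rewrite scale0r addr0.
- move=> U x; have [T2 F] := HP x; have [T2' F'] := HP (flow S U x).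
  by apply/esym/(framed_unique rig _ F'); exact: framed_flow F.
- move=> c x cA xc; have [T2 F] := HP x.
  have [tau [st _ n]] := framed_section cA xc F.
  apply: (@smooth_ext _ _ _ (tau \o chart_inv c)) => //.
  apply: filterS (near_chart_inv cA xc n) => v /= [T2' F'].
  by have [T2'' F''] := HP (chart_inv c v); exact: (framed_unique rig F' F'').
Qed.

End PeriodSection.

(** * The circle action *)

Section Angle.
Context {R : realType}.

Definition turn (a : R) : R * R := (cos (a * (pi *+ 2)), sin (a * (pi *+ 2))).

Lemma turnD (a b : R) : turn (a + b) =
  ((turn a).1 * (turn b).1 - (turn a).2 * (turn b).2,
   (turn a).1 * (turn b).2 + (turn a).2 * (turn b).1).
Proof. by rewrite /turn mulrDl cosD sinD /=; congr (_, _); rewrite addrC. Qed.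

Lemma turnN (a : R) : turn (- a) = ((turn a).1, - (turn a).2).
Proof. by rewrite /turn mulNr cosN sinN. Qed.

Lemma turn0 : turn 0 = (1, 0).
Proof. by rewrite /turn mul0r cos0 sin0. Qed.

Lemma turn_int (m : int) : turn m%:~R = (1, 0).
Proof.
have H (q : nat) : turn q%:~R = (1, 0).
  elim: q => [|q IH]; first exact: turn0.
  rewrite intS rmorphD /= turnD IH {1 2 3 4}/turn !mul1r cos2pi sin2pi /=.
  by rewrite !mulr0 !mulr1 subr0 addr0.
case: m => q; first exact: H.
by rewrite NegzE rmorphN /= turnN H oppr0.
Qed.

(** After subtraction of the nearest integer the angle has absolute value at most [pi]; its cosine
    is 1, and [cos] is injective on [[0, pi]]. *)
Lemma turn_inj (a b : R) : turn a = turn b -> exists m : int, a = b + m%:~R.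
Proof.
move=> E; have [m Hm] := nearest_int (a - b); exists m.
have : turn (a - b - m%:~R) = (1, 0).
  have E1 : turn (a - b) = (1, 0).
    rewrite turnD turnN E /turn /= mulrN opprK -!expr2 cos2Dsin2.
    by rewrite mulrN mulrC addNr.
  by rewrite turnD turnN turn_int E1 /= oppr0 !mulr0 !mulr1 subr0 addr0.
rewrite /turn => -[]; set y := _ * _ => cosy _.
have pi0 : 0 <= (pi : R) by exact: pi_ge0.
have ypi : `|y| <= pi.
  rewrite normrM (ger0_norm (mulrn_wge0 2 pi0)) mulr2n.
  by have := ler_wpM2r pi0 Hm; lra.
have y0 : `|y| = 0.
  apply: (@cos_inj R).
  - by rewrite in_itv /= normr_ge0 ypi.
  - by rewrite in_itv /= lexx pi0.
  - by rewrite cos_norm cosy cos0.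
move/eqP: y0; rewrite normr_eq0 mulf_eq0 => /orP[/eqP e|].
  by rewrite -[LHS](subrK b) -(subrK m%:~R (a - b)) e add0r addrC.
by rewrite mulrn_eq0 /= gt_eqF // pi_gt0.
Qed.

(* The point at stereographic coordinate [t] has angle
   [(-1) ^+ b * (2 * atan t - pi / 2)]. *)
Definition stereo_turn (b : bool) (t : R) : R := (-1) ^+ b * (atan t / pi - 4^-1).

Lemma turn_stereo b t : turn (stereo_turn b t) =
  (2 * t / (t ^+ 2 + 1), (-1) ^+ b * ((t ^+ 2 - 1) / (t ^+ 2 + 1))).
Proof.
have pi0 : (pi : R) != 0 by rewrite gt_eqF // pi_gt0.
have t1 : t ^+ 2 + 1 != 0 by rewrite gt_eqF // ltr_wpDl // sqr_ge0.
have turnF : turn (atan t / pi - 4^-1) = (2 * t / (t ^+ 2 + 1), (t ^+ 2 - 1) / (t ^+ 2 + 1)).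
  have -> : turn (atan t / pi - 4^-1) = (sin (atan t *+ 2), - cos (atan t *+ 2)).
    have -> : turn (atan t / pi - 4^-1) =
      (cos (atan t *+ 2 - pi / 2), sin (atan t *+ 2 - pi / 2)).
      have argE : (atan t / pi - 4^-1) * (pi *+ 2) = atan t *+ 2 - pi / 2.
        move: (pi : R) (atan t) pi0 => p A p0.
        by rewrite -(mulr_natr p) -(mulr_natr A); field.
      by rewrite /turn argE.
    by rewrite cosBpihalf sinBpihalf.
  have C0 : cos (atan t) != 0.
    by rewrite gt_eqF // cos_gt0_pihalf // atan_gtNpi2 atan_ltpi2.
  have SE : sin (atan t) = t * cos (atan t).
    by rewrite -{2}(atanK t) /tan divfK.
  have C2 : cos (atan t) ^+ 2 = (t ^+ 2 + 1)^-1.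
    by rewrite -[LHS]invrK cos2_tan2 // atanK addrC.
  rewrite sin_mulr2n cos_mulr2n SE; congr (_, _).
    by rewrite mulrCA -expr2 C2 -mulr_natr; field.
  by rewrite C2 -mulr_natr; field.
rewrite /stereo_turn; case: b; rewrite /= ?expr1 ?expr0 ?mulN1r ?mul1r //.
by rewrite turnN turnF.
Qed.

(** This gives a smooth branch of the argument on each chart, to replace the arbitrary choice
    [S1_turn] where regularity is proved. *)
Lemma S1_chart_turn b (z : S1 R) : chart_dom (S1_chart R b) z ->
  val z = turn (stereo_turn b (S1_chart R b z 0 0)).
Proof.
case: z => -[z1 z2] zP /= zb; rewrite turn_stereo mxE /=.
have zE : z1 ^+ 2 + z2 ^+ 2 = 1 := set_mem zP.
have s2 : ((-1) ^+ b : R) ^+ 2 = 1 by rewrite sqrr_sign.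
move: ((-1) ^+ b : R) s2 zb => s s2 zb.
set d := 1 - s * z2.
have d0 : d != 0.
  rewrite /d subr_eq0; apply: contra_neq zb => E.
  by rewrite -[RHS]mulr1 E mulrA -expr2 s2 mul1r.
have tE : (z1 / d) ^+ 2 + 1 = 2 / d.
  have -> : (z1 / d) ^+ 2 + 1 = (z1 ^+ 2 + d ^+ 2) / d ^+ 2 by field.
  have -> : z1 ^+ 2 + d ^+ 2 = 2 * d.
    have -> : z1 ^+ 2 = 1 - z2 ^+ 2 by rewrite -zE addrK.
    have -> : d ^+ 2 = 1 - 2 * (s * z2) + s ^+ 2 * z2 ^+ 2 by rewrite /d; ring.
    by rewrite s2 /d; ring.
  by field.
have tE' : (z1 / d) ^+ 2 - 1 = 2 * (s * z2) / d.
  have -> : (z1 / d) ^+ 2 - 1 = 2 / d - 2 by rewrite -tE; ring.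
  have -> : s * z2 = 1 - d by rewrite /d; ring.
  by field.
rewrite tE tE'; congr (_, _); first by field.
have -> : s * (2 * (s * z2) / d / (2 / d)) = s ^+ 2 * z2 by field.
by rewrite s2 mul1r.
Qed.

Lemma S1_arg (z : S1 R) : exists a, val z = turn a.
Proof.
have [zb|zb] := boolP ((val z).2 != (-1) ^+ false).
  by exists (stereo_turn false (S1_chart R false z 0 0)); exact: S1_chart_turn.
exists (stereo_turn true (S1_chart R true z 0 0)); apply: S1_chart_turn => /=.
move: zb; rewrite negbK expr0 expr1 => /eqP ->.
by rewrite -subr_eq0 opprK -mulr2n mulrn_eq0 oner_eq0.
Qed.

Definition S1_turn (z : S1 R) : R := xget 0 [set a | val z = turn a].

Lemma S1_turnP z : val z = turn (S1_turn z).
Proof. by have [a za] := S1_arg z; rewrite /S1_turn; case: xgetP => [_ -> //|/(_ a)/(_ za)]. Qed.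

Lemma Cr_atan (V : normedModType R) r (U : set V) (f : V -> R) : open U ->
  Cr r U f -> Cr r U (fun x => atan (f x)).
Proof.
move=> oU; elim: r => [|r IH].
  by move=> Hf x Ux; apply: (@continuous_comp _ _ _ f atan); [exact: Hf|exact: continuous_atan].
move=> Hf; have [df Hf'] := Hf.
have dat (y : R) : differentiable (atan : R -> R) y by apply/derivable1_diffP; exact: derivable_atan.
split=> [x Ux|v]; first by apply: (@differentiable_comp _ _ _ _ f atan) => //; exact: df.
apply: (@Cr_ext _ _ _ _ _ (fun x => 'D_v f x * (1 + f x * f x)^-1)) => //.
  move=> x Ux; have dfx := df x Ux.
  have dc : differentiable (atan \o f) x by exact: differentiable_comp.
  apply/esym; apply: etrans (deriveE v dc) _.
  apply: etrans (congr1 (fun g => g v) (diff_comp dfx (dat _))) _.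
  rewrite (deriveE v dfx) /= (deriv1E (@derivable_atan R (f x))).
  by rewrite derive1_atan expr2.
apply: CrM => //; first exact: Hf'.
apply: CrV => //.
  by move=> x _; rewrite gt_eqF // ltr_pwDl // -expr2 sqr_ge0.
by apply: CrD => //; [exact: Cr_cst|apply: CrM => //; exact: CrS].
Qed.

Lemma smooth_stereo_turn (V : normedModType R) b (f : V -> R) x :
  smooth f x -> smooth (fun y => stereo_turn b (f y)) x.
Proof.
move=> [U [oU Ux Hf]]; exists U; split=> // r.
apply: CrM => //; first exact: Cr_cst.
apply: CrB => //; last exact: Cr_cst.
by apply: CrM => //; [exact: Cr_atan|exact: Cr_cst].
Qed.

Lemma stereo_turn_continuous b : continuous (stereo_turn b).
Proof.
move=> t.
apply: (@continuousM _ _ (fun=> (-1) ^+ b) (fun t => atan t / pi - 4^-1)).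
  exact: cst_continuous.
apply: (@continuousB _ _ _ (fun t : R => atan t / pi) (fun=> 4^-1)); last exact: cst_continuous.
apply: (@continuousM _ _ atan (fun=> pi^-1)); last exact: cst_continuous.
exact: continuous_atan.
Qed.

Lemma S1_chart_continuous b (z : S1 R) : chart_dom (S1_chart R b) z ->
  {for z, continuous (fun w => S1_chart R b w 0 0)}.
Proof.
move=> /= zb.
have -> : (fun w => S1_chart R b w 0 0) = (fun w : S1 R => (val w).1 / (1 - (-1) ^+ b * (val w).2)).
  by apply/funext => w; rewrite mxE.
have cv : {for z, continuous (fun w : S1 R => val w)} by exact: initial_continuous.
have c1 : {for z, continuous (fun w : S1 R => (val w).1)}.
  by apply: (@continuous_comp _ _ _ (fun w : S1 R => val w) fst); [exact: cv|exact: cvg_fst].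
have c2 : {for z, continuous (fun w : S1 R => (val w).2)}.
  by apply: (@continuous_comp _ _ _ (fun w : S1 R => val w) snd); [exact: cv|exact: cvg_snd].
apply: continuousM => //; apply: continuousV.
  move: ((-1) ^+ b : R) (sqrr_sign R b) zb => s s2; rewrite subr_eq0; apply: contra_neq => E.
  by rewrite -[RHS]mulr1 E mulrA -expr2 s2 mul1r.
apply: continuousB; first exact: cst_continuous.
by apply: continuousM; first exact: cst_continuous.
Qed.

Lemma near_S1_chart_dom b (z : S1 R) : chart_dom (S1_chart R b) z ->
  \forall w \near z, chart_dom (S1_chart R b) w.
Proof.
move=> /= zb.
have c2 : {for z, continuous (fun w : S1 R => (val w).2)}.
  apply: (@continuous_comp _ _ _ (fun w : S1 R => val w) snd); last exact: cvg_snd.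
  exact: initial_continuous.
apply: (c2 [set a | a != (-1) ^+ b]).
by apply: open_nbhs_nbhs; split=> //; exact: open_neq.
Qed.

End Angle.

Section CircleAction.
Context {R : realType} {k n : nat} (S : integrable_system R k n).
Variable P : S -> 'rV[R]_n.
Hypothesis P_isotropy : forall x, isotropy (flow S) x (P x).
Hypothesis P_primitive : forall x (a : R), isotropy (flow S) x (a *: P x) ->
  exists m : int, a = m%:~R.
Hypothesis P_flow : forall U x, P (flow S U x) = P x.
Hypothesis P_smooth : forall c x, atlas S c -> chart_dom c x ->
  smooth (P \o chart_inv c) (c x).

Definition period_action (z : S1 R) (x : S) : S := flow S (S1_turn z *: P x) x.

(** Two arguments of [z] differ by an integer, and integer multiples of [P x] are periods of [x]; so
    any branch of the argument computes the action. *)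
Lemma period_actionE z a x : val z = turn a -> period_action z x = flow S (a *: P x) x.
Proof.
rewrite S1_turnP => /turn_inj[m E]; rewrite /period_action E scalerDl flowD scaler_int.
by congr flow; exact: isotropyMz.
Qed.

Lemma period_action_flow z T x : period_action z (flow S T x) = flow S T (period_action z x).
Proof. by rewrite /period_action P_flow -!flowD addrC. Qed.

Lemma period_action_one x : period_action (S1_one R) x = x.
Proof. by rewrite (@period_actionE _ 0) ?scale0r ?flow0 // turn0. Qed.

Lemma period_action_mul z w x :
  period_action (S1_mul z w) x = period_action z (period_action w x).
Proof.
rewrite (@period_actionE _ (S1_turn z + S1_turn w)).
  by rewrite /period_action P_flow -flowD scalerDl.
by rewrite turnD -!S1_turnP.
Qed.

Lemma period_action_orbit z x : quotient_map (period_action z x) = quotient_map x.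
Proof.
apply: val_inj; rewrite /= /period_action; set T := _ *: _.
apply/seteqP; split=> _ [U _ <-].
  by exists (U + T) => //; rewrite flowD.
by exists (U - T) => //; rewrite -flowD subrK.
Qed.

Lemma period_action_free : free_S1_action period_action.
Proof.
move=> z x zx; have [m mE] := P_primitive zx.
by apply: val_inj; rewrite S1_turnP mE turn_int.
Qed.

Lemma period_continuous : continuous P.
Proof.
move=> x; have [_ /(_ x)[c cA xc] _] := atlasP S.
exact: (chart_smooth_continuous cA xc (P_smooth cA xc)).
Qed.

Lemma period_action_continuous : continuous (fun p : S1 R * S => period_action p.1 p.2).
Proof.
move=> [z x].
have [b zb] : exists b, chart_dom (S1_chart R b) z.
  have [zb|zb] := pselect (chart_dom (S1_chart R false) z); first by exists false.
  exists true; move/negP: zb => /=; rewrite negbK expr0 expr1 => /eqP ->.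
  by rewrite -subr_eq0 opprK -mulr2n mulrn_eq0 oner_eq0.
pose f (p : S1 R * S) := flow S (stereo_turn b (S1_chart R b p.1 0 0) *: P p.2) p.2.
have cf : {for (z, x), continuous f}.
  apply: flow_continuous2; last exact: cvg_snd.
  have c1 : {for (z, x), continuous (fun p : S1 R * S => stereo_turn b (S1_chart R b p.1 0 0))}.
    apply: (@continuous_comp _ _ _ (fun p : S1 R * S => S1_chart R b p.1 0 0) (stereo_turn b)).
      apply: (@continuous_comp _ _ _ fst (fun w : S1 R => S1_chart R b w 0 0)).
        exact: cvg_fst.
      exact: S1_chart_continuous.
    exact: stereo_turn_continuous.
  have c2 : {for (z, x), continuous (fun p : S1 R * S => P p.2)}.
    by apply: (@continuous_comp _ _ _ snd P); [exact: cvg_snd|exact: period_continuous].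
  exact: (@cvgZ _ _ _ _ (nbhs_filter (z, x)) _ _ _ _ c1 c2).
have near_f : \forall p \near (z, x), f p = period_action p.1 p.2.
  have nb : \forall p \near (z, x), chart_dom (S1_chart R b) p.1.
    exact: (@cvg_fst _ _ (nbhs z) (nbhs x) _ _ (near_S1_chart_dom zb)).
  apply: filterS nb => p pb.
  by rewrite (period_actionE _ (S1_chart_turn pb)).
rewrite /continuous_at -(nbhs_singleton near_f).
by apply: cvg_trans cf; exact: near_eq_cvg.
Qed.

Lemma period_action_smooth :
  smooth_map (prod_atlas (S1_atlas R) (atlas S)) (atlas S) (fun p => period_action p.1 p.2).
Proof.
split; first exact: period_action_continuous.
move=> _ c' [z x] [_ [b _ <-] [c cA <-]] c'A [/= zb xc] zxc'; apply/smooth_atE.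
pose t (u : 'rV[R]_(1 + (k + n))) := stereo_turn b (lsubmx u 0 0).
pose g u := row_mx (t u *: P (chart_inv c (rsubmx u))) (rsubmx u).
pose u0 : 'rV[R]_(1 + (k + n)) := row_mx (S1_chart R b z) (c x).
have zt : val z = turn (stereo_turn b (S1_chart R b z 0 0)) by exact: S1_chart_turn.
(* The identity holds for every [u], since [stereo_turn b] is an argument of the inverse
   stereographic projection on the whole line. *)
have -> : (c' \o (fun p => period_action p.1 p.2) \o chart_inv (prod_chart (S1_chart R b) c)) =
    flow_chart c c' \o g.
  apply/funext => u; rewrite /= /flow_chart /g row_mxKl row_mxKr; congr (c' _).
  by apply: period_actionE; rewrite /= turn_stereo.
apply: smooth_comp.
  apply: smooth_row_mx; last by apply: smooth_rsubmx; exact: smooth_id.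
  have sP : smooth (fun u : 'rV[R]_(1 + (k + n)) => P (chart_inv c (rsubmx u))) u0.
    apply: (@smooth_comp _ _ _ _ (P \o chart_inv c) rsubmx).
      by apply: smooth_rsubmx; exact: smooth_id.
    by rewrite row_mxKr; exact: P_smooth.
  apply/smooth_coordP => j.
  have -> : (fun u => (t u *: P (chart_inv c (rsubmx u))) 0 j) =
      (fun u => t u * P (chart_inv c (rsubmx u)) 0 j).
    by apply/funext => u; rewrite mxE.
  apply: smoothM; last by move/smooth_coordP: sP; apply.
  apply: smooth_stereo_turn.
  have /smooth_coordP : smooth (fun u : 'rV[R]_(1 + (k + n)) => lsubmx u) u0.
    by apply: smooth_lsubmx; exact: smooth_id.
  exact.
rewrite /g /t row_mxKl row_mxKr (chart_mapK cA xc).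
by apply: flow_chart_smooth => //; rewrite -(period_actionE _ zt).
Qed.

Lemma period_action_compatible : compatible_S1_action period_action.
Proof.
split; last exact: period_action_orbit.
- split; [exact: period_action_smooth|exact: period_action_one|exact: period_action_mul].
- exact: period_action_flow.
Qed.

End CircleAction.


Theorem theorem19 (R : realType) (k : nat) (S : integrable_system R k 2)
    (S_connected : connected [set: S])
    (rho_nontrivial : exists l : lattice_bundle S, rho l != 0) :
  exists Theta : S1 R -> S -> S,
    compatible_S1_action Theta /\ free_S1_action Theta.
Proof.
have [P [P_isotropy P_primitive P_flow P_smooth]] : exists P : S -> 'rV[R]_2,
  [/\ forall x, isotropy (flow S) x (P x),
      forall x (a : R), isotropy (flow S) x (a *: P x) -> exists m : int, a = m%:~R,
      forall U x, P (flow S U x) = P x &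
      forall c x, atlas S c -> chart_dom c x -> smooth (P \o chart_inv c) (c x)].
  apply: period_section => //; have [[y T] rhoT] := rho_nontrivial.
  have Tx : isotropy (flow S) (orbit_point y) (val T).
    exact: (set_mem (valP T) _ (orbit_pointP y)).
  exists (orbit_point y), (val T); split=> //.
  rewrite (rho_atE Tx); move: rhoT; rewrite /rho /=.
  by rewrite (Prop_irrelevance (set_mem (valP T) _ (orbit_pointP y)) Tx).
exists (period_action P); split.
  exact: period_action_compatible.
exact: period_action_free.
Qed.
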